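(* Let $\beta\in\mathbb C$ with $\beta^4=1$, $H=\mathsf Q(2,\beta)$ the symplectic fermion ribbon quasi-Hopf algebra with $N=2$, $A\subset H$ the quasi-Hopf subalgebra generated by $\mathsf K,\mathsf f_1^\pm$, $\mathcal C$ the ribbon category of finite-dimensional $H$-modules, $\mathcal I\subset\mathcal C$ the tensor ideal of $H$-modules that are projective as $A$-modules, and $\mathsf t^{\mathcal I}$ the pullback modified trace given in the context. For $\mu\in\mathrm{Mat}_2(\mathbb C)$ let $P_\mu\in\mathcal I$ be the corresponding module. Then, for all $\mu\in\mathrm{Mat}_2(\mathbb C)$, $n,a,b\in\mathbb Z$ and odd $m\in\mathbb Z$, the renormalised invariants are: - $n$-framed unknot: $F'_{\mathcal C,\mathsf t^{\mathcal I}}(O(n,P_\mu))=2n(1+\det\mu)$; - $(2,m)$-torus knot: $F'_{\mathcal C,\mathsf t^{\mathcal I}}(T(m,P_\mu))=2m(1+\det\mu)$; - framed Hopf link: $F'_{\mathcal C,\mathsf t^{\mathcal I}}(S(P_\mu,a;X_0^\pm,b))=\pm2a(1+\det\mu)$ and $F'_{\mathcal C,\mathsf t^{\mathcal I}}(S(P_\mu,a;X_1^\pm,b))=0$.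
   Context: Algebra: $H=\mathsf{Q}(2,\beta)$ is the unital $\mathbb{C}$-algebra generated by $\mathsf{K},\mathsf{f}_i^\pm$ ($i=1,2$) with relations, for $\boldsymbol e_0=\frac12(1+\mathsf K^2)$, $\boldsymbol e_1=\frac12(1-\mathsf K^2)$: $\{\mathsf f_i^\pm,\mathsf K\}=0$, $\{\mathsf f_i^+,\mathsf f_j^-\}=\delta_{ij}\boldsymbol e_1$, $\{\mathsf f_i^\pm,\mathsf f_j^\pm\}=0$, $\mathsf K^4=1$. Quasi-Hopf structure: $\Delta(\mathsf K)=\mathsf K\otimes\mathsf K-2\boldsymbol e_1\mathsf K\otimes\boldsymbol e_1\mathsf K$, $\Delta(\mathsf f_i^\pm)=\mathsf f_i^\pm\otimes1+\omega_\pm\otimes\mathsf f_i^\pm$, $\omega_\pm=(\boldsymbol e_0\pm i\boldsymbol e_1)\mathsf K$; $\varepsilon(\mathsf K)=1$, $\varepsilon(\mathsf f_i^\pm)=0$; $\boldsymbol\beta_\pm=\boldsymbol e_0+\beta^2(\pm i\mathsf K)^2\boldsymbol e_1$, $\Phi^{\pm1}=1\otimes1\otimes1+\boldsymbol e_1\otimes\boldsymbol e_1\otimes\{\boldsymbol e_0(\mathsf K^2-1)+\boldsymbol e_1(\boldsymbol\beta_\pm-1)\}$; $S(\mathsf K)=\mathsf K$, $S(\mathsf f_i^\pm)=\mathsf f_i^\pm(\boldsymbol e_0\pm i\boldsymbol e_1)\mathsf K$, $\boldsymbol\alpha=1$, $\boldsymbol\beta=\boldsymbol\beta_+$. $\mathsf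 R=\big(\sum_{n,m=0}^1\beta^{nm}\rho_{n,m}\,\boldsymbol e_n\otimes\boldsymbol e_m\big)\prod_{j=1}^2(1\otimes1-2\mathsf f_j^-\omega_-\otimes\mathsf f_j^+)$, $\rho_{n,m}=\frac12\sum_{k,l=0}^1(-1)^{kl}i^{-kn+lm}\mathsf K^k\otimes\mathsf K^l$. Ribbon element $\boldsymbol v=(\boldsymbol e_0-\beta i\mathsf K\boldsymbol e_1)\prod_j(1-2\mathsf f_j^+\mathsf f_j^-)$, pivot $\boldsymbol g=(\boldsymbol e_0+(-i)^{3}\boldsymbol e_1\mathsf K^2)\mathsf K$. Category $\mathcal{C}$: tensor product via $\Delta$; associator $U(VW)\to(UV)W$ acts by $\Phi$; dual $V^\vee=V^*$ with $(h.f)(v)=f(S(h)v)$, $\mathrm{ev}(f\otimes v)=f(\boldsymbol\alpha v)$, $\mathrm{coev}(1)=\sum\boldsymbol\beta v_i\otimes v^i$, $\widetilde{\mathrm{ev}}(v\otimes f)=f(S(\boldsymbol\alpha)\boldsymbol gv)$, $\widetilde{\mathrm{coev}}(1)=\sum v^i\otimes S^{-1}(\boldsymbol g\boldsymbol\beta)v_i$; braiding $c(x\otimes y)=\mathsf R_2y\otimes\mathsf R_1x$; twist $\theta_V=\boldsymbol v^{-1}.(-)$. Modules: $X_0^\pm$ is one-dimensional with $\mathsf K=\pm1$ and $\mathsf f_j^\pm=0$. With $\boldsymbol e_1^\pm=\frac12\boldsymbol e_1\big(1\mp i\mathsf K\prod_{j}(1-2\mathsf f_j^+\mathsf f_j^-)\big)$,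 $X_1^\pm$ is the 4-dimensional simple projective module with $H\boldsymbol e_1^\pm\cong(X_1^\pm)^{\oplus4}$. $P_0^+(A)$, the projective cover of the trivial $A$-module, has basis $v_0,\mathsf f_1^+v_0,\mathsf f_1^-v_0,\mathsf f_1^+\mathsf f_1^-v_0$ with $\mathsf Kv_0=v_0$; for $\mu=\begin{pmatrix} a^- & a^+ \\ b^- & b^+ \end{pmatrix}$, $P_\mu$ is $P_0^+(A)$ with $\mathsf f_2^\varepsilon$ acting as $a^\varepsilon\mathsf f_1^-+b^\varepsilon\mathsf f_1^+$. Modified trace: $\widehat\lambda^{A}\in A^*$ is $\widehat\lambda^A(\mathsf f_1^+\mathsf f_1^-\mathsf K^m)=\delta_{m,1}-i\beta^2\delta_{m,3}$ and $0$ on other basis vectors $(\mathsf f_1^+)^s(\mathsf f_1^-)^t\mathsf K^m$. It determines the unique right modified trace $\mathsf t^{A}$ on projective $A$-modules (a family of linear maps $\mathsf t_X:\mathrm{End}(X)\to\mathbb C$ with $\mathsf t_X(gf)=\mathsf t_Y(fg)$ and $\mathsf{t}_{X\otimes V}(f)=\mathsf{t}_X\big((\mathrm{id}_X\otimes\widetilde{\mathrm{ev}}_V)(f\otimes\mathrm{id})(\mathrm{id}_X\otimes\mathrm{coev}_V)\big)$) with $\mathsf t^A_{Ae}(f)=\widehat\lambda^A(f(e))$ for idempotents $e\in A$, $f\in\mathrm{End}_A(Ae)$. For $M\in\mathcal I$, $f\in\mathrm{End}_H(M)$: $\mathsf t^{\mathcal I}_M(f)=\frac4{1-i\beta^2}\mathsf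 t^A_{M|_A}(f)$, a modified trace on $\mathcal I$. Invariants: a closed $\mathcal C$-coloured ribbon graph $T$ with an edge coloured by $X\in\mathcal I$ is cut at this edge to give $T_X$ from $X$ to $X$, and $F'_{\mathcal C,\mathsf t^{\mathcal I}}(T)=\mathsf t^{\mathcal I}_X(F_{\mathcal C}(T_X))$ with $F_{\mathcal C}$ the Reshetikhin-Turaev functor (well defined). Links: $O(n,X)$ is the $X$-coloured unknot with framing $n$ (closure of $\theta_X^n$); $T(m,X)$, $m$ odd, is the closure of the braid $c_{X,X}^m$ (blackboard framing); $S(X,a;U,b)$ is the Hopf link given by the closure of $(\theta_X^a\otimes\theta_U^b)\circ c_{U,X}\circ c_{X,U}$. *)

(* Defs.v *)
From HB Require Import structures.
From mathcomp Require Import all_boot all_order all_algebra all_field.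
From mathcomp Require Import reals.
From mathcomp.real_closed Require Import complex.

Set Implicit Arguments.
Unset Strict Implicit.
Unset Printing Implicit Defensive.

Import Order.TTheory GRing.Theory Num.Theory.
Local Open Scope ring_scope.

(* V (x) W is encoded by coefficient matrices with respect to the chosen      *)
(* bases of V and W, and [tlift b] is the linear map induced by a bilinear    *)
(* map [b]; [tliftE] and [tens_ext] give the universal property.              *)
Section Tensor.
Variable F : fieldType.
Implicit Types U V W Z : vectType F.

Lemma lfun_linE V W (f : V -> W) : linear f -> linfun f =1 f.
Proof.
move=> lin v.
pose G : {linear V -> W} := HB.pack f (GRing.isLinear.Build F _ _ _ _ lin).
exact: (lfunE G v).
Qed.

Definition tens V W : vectType F := 'M[F]_(\dim {:V}, \dim {:W}).

Definition bvec V (i : 'I_(\dim {:V})) : V := (vbasis {:V})`_i.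

Definition bcovec V (i : 'I_(\dim {:V})) : 'Hom(V, F^o) :=
  linfun (coord (vbasis {:V}) i : V -> F^o).

Definition pure V W (v : V) (w : W) : tens V W :=
  \matrix_(i, j) (bcovec i v * bcovec j w).

Definition tlift V W Z (b : V -> W -> Z) : 'Hom(tens V W, Z) :=
  linfun (fun M : 'M[F]_(\dim {:V}, \dim {:W}) =>
    \sum_i \sum_j M i j *: b (bvec i) (bvec j)).

Lemma bcovecE V (i : 'I_(\dim {:V})) v : bcovec i v = coord (vbasis {:V}) i v.
Proof. by rewrite lfunE. Qed.

Lemma bvec_sum V (v : V) : v = \sum_i bcovec i v *: bvec i.
Proof.
rewrite {1}(coord_vbasis (memvf v)).
by apply: eq_bigr => i _; rewrite bcovecE.
Qed.

Lemma bcovec_bvec V (i j : 'I_(\dim {:V})) : bcovec i (bvec j) = (i == j)%:R.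
Proof. by rewrite bcovecE /bvec coord_free ?(basis_free (vbasisP _)) // eq_sym.
Qed.

Lemma tlift_linear V W Z (b : V -> W -> Z) :
  linear (fun M : 'M[F]_(\dim {:V}, \dim {:W}) =>
    \sum_i \sum_j M i j *: b (bvec i) (bvec j)).
Proof.
move=> c M N; rewrite scaler_sumr -big_split; apply: eq_bigr => i _ /=.
rewrite scaler_sumr -big_split; apply: eq_bigr => j _ /=.
by rewrite !mxE scalerDl scalerA.
Qed.

Lemma tlift_val V W Z (b : V -> W -> Z) (M : 'M[F]_(\dim {:V}, \dim {:W})) :
  tlift b (M : tens V W) = \sum_i \sum_j M i j *: b (bvec i) (bvec j).
Proof. exact: lfun_linE (tlift_linear b) M. Qed.

Lemma tliftE V W Z (b : V -> W -> Z) v w :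
  (forall w, linear (b^~ w)) -> (forall v, linear (b v)) ->
  tlift b (pure v w) = b v w.
Proof.
move=> bl br; rewrite tlift_val.
have b0l w' : b 0 w' = 0.
  by have := bl w' (-1) 0 0; rewrite scaler0 addr0 scaleN1r addNr.
have b0r v' : b v' 0 = 0.
  by have := br v' (-1) 0 0; rewrite scaler0 addr0 scaleN1r addNr.
have sl (I : finType) (c : I -> F) (x : I -> V) w' :
    b (\sum_i c i *: x i) w' = \sum_i c i *: b (x i) w'.
  elim/big_rec2: _ => [|i y z _ <-]; first exact: b0l.
  exact: (bl w' (c i) (x i) z).
have sr (I : finType) (c : I -> F) (x : I -> W) v' :
    b v' (\sum_i c i *: x i) = \sum_i c i *: b v' (x i).
  elim/big_rec2: _ => [|i y z _ <-]; first exact: b0r.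
  exact: (br v' (c i) (x i) z).
rewrite [in RHS](bvec_sum v) sl; apply: eq_bigr => i _.
rewrite [in RHS](bvec_sum w) sr scaler_sumr; apply: eq_bigr => j _.
by rewrite mxE scalerA.
Qed.

Lemma pure_linl V W (w : W) : linear (fun v : V => pure v w).
Proof.
move=> c v v'; apply/matrixP => i j.
by rewrite !mxE linearP /= mulrDl mulrA.
Qed.

Lemma pure_linr V W (v : V) : linear (fun w : W => pure v w).
Proof.
move=> c w w'; apply/matrixP => i j.
by rewrite !mxE linearP /= mulrDr mulrCA.
Qed.

Lemma tens_sum V W (M : 'M[F]_(\dim {:V}, \dim {:W})) :
  (M : tens V W) = \sum_i \sum_j M i j *: pure (bvec i) (bvec j).
Proof.
rewrite {1}[M]matrix_sum_delta; apply: eq_bigr => i _.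
apply: eq_bigr => j _; congr (_ *: _).
apply/matrixP => k l; rewrite !mxE !bcovec_bvec.
by case: (k == i); rewrite ?mul0r ?mul1r.
Qed.

Lemma tens_ext V W Z (f g : 'Hom(tens V W, Z)) :
  (forall v w, f (pure v w) = g (pure v w)) -> f = g.
Proof.
move=> fg; apply/lfunP => M; rewrite [M]tens_sum !linear_sum.
apply: eq_bigr => i _; rewrite !linear_sum; apply: eq_bigr => j _.
by rewrite !linearZ /= fg.
Qed.

Lemma tens_ind V W (P : tens V W -> Prop) :
  (forall c x y, P x -> P y -> P (c *: x + y)) ->
  (forall v w, P (pure v w)) -> forall x, P x.
Proof.
move=> Plin Ppure x.
have P0 : P 0.
  by have := Plin (-1) _ _ (Ppure 0 0) (Ppure 0 0); rewrite scaleN1r addNr.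
rewrite [x]tens_sum; elim/big_rec: _ => // i y _ Py.
rewrite -[_ + y]addr0 -addrA.
have: P (y + 0) by rewrite addr0.
move: (y + 0) => z Pz; elim/big_rec: _ => [|j t _ Pt]; first by rewrite add0r.
by rewrite -addrA; apply: Plin.
Qed.

Definition tmap V W V' W' (f : 'Hom(V, V')) (g : 'Hom(W, W')) :
    'Hom(tens V W, tens V' W') :=
  tlift (fun v w => pure (f v) (g w)).

Lemma tmapE V W V' W' (f : 'Hom(V, V')) (g : 'Hom(W, W')) v w :
  tmap f g (pure v w) = pure (f v) (g w).
Proof.
rewrite /tmap tliftE // => [w'|v'] c x y; rewrite linearP.
  exact: pure_linl.
exact: pure_linr.
Qed.

Definition dual V : vectType F := 'Hom(V, F^o).

Definition rebracket U V W : 'Hom(tens U (tens V W), tens (tens U V) W) :=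
  tlift (fun u => tlift (fun v w => pure (pure u v) w)).

Definition unbracket U V W : 'Hom(tens (tens U V) W, tens U (tens V W)) :=
  tlift (fun uv w => tlift (fun u v => pure u (pure v w)) uv).

Lemma rebracketE U V W (u : U) (v : V) (w : W) :
  rebracket U V W (pure u (pure v w)) = pure (pure u v) w.
Proof.
have in_lift (u' : U) v' w' :
    tlift (fun v w => pure (pure u' v) w) (pure v' w' : tens V W) =
    pure (pure u' v') w'.
  rewrite tliftE // => [z|z] c y y' /=; last by rewrite pure_linr.
  by rewrite pure_linr pure_linl.
rewrite /rebracket tliftE ?in_lift // => [x|x] c y y'; last by rewrite linearP.
elim/tens_ind: x => [d x x' Hx Hx'|v' w'].
  by rewrite !linearP /= Hx Hx' !scalerDr !scalerA [d * c]mulrC addrACA.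
by rewrite !in_lift !pure_linl.
Qed.

Lemma unbracketE U V W (u : U) (v : V) (w : W) :
  unbracket U V W (pure (pure u v) w) = pure u (pure v w).
Proof.
have in_lift u' v' (w' : W) :
    tlift (fun u v => pure u (pure v w')) (pure u' v' : tens U V) =
    pure u' (pure v' w').
  rewrite tliftE // => [z|z] c y y' /=; first by rewrite pure_linl.
  by rewrite pure_linl pure_linr.
rewrite /unbracket tliftE ?in_lift // => [x|x] c y y'; first by rewrite linearP.
elim/tens_ind: x => [d x x' Hx Hx'|u' v'].
  by rewrite !linearP /= Hx Hx' !scalerDr !scalerA [d * c]mulrC addrACA.
by rewrite !in_lift !pure_linr.
Qed.

End Tensor.

Section Modules.
Variables (F : fieldType) (B : falgType F).

Record amod := AMod {
  carrier :> vectType F;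
  act : 'Hom(B, 'End(carrier));
  act1 : act 1 = \1%VF;
  actM : forall a b : B, act (a * b) = (act a \o act b)%VF }.

Implicit Types M N X : amod.

Definition amorph M N (f : 'Hom(M, N)) : Prop :=
  forall a : B, (f \o act M a = act N a \o f)%VF.

Definition aiso M N : Prop :=
  exists2 f : 'Hom(M, N), amorph f & bijective f.

(* Lifting property against epimorphisms of finite-dimensional modules.       *)
Definition aprojective X : Prop :=
  forall (M N : amod) (g : 'Hom(M, N)) (f : 'Hom(X, N)),
    amorph g -> limg g = fullv -> amorph f ->
    exists2 h : 'Hom(X, M), amorph h & (g \o h = f)%VF.

Definition asimple X : Prop :=
  {:X}%VS <> 0%VS /\
  forall U : {vspace X}, (forall a : B, act X a @: U <= U)%VS ->
    U = 0%VS \/ U = {:X}%VS.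

Section LeftIdeal.
Variable e : B.
Definition left_ideal : {vspace B} := limg (amulr e).

Lemma left_idealM (a x : B) : x \in left_ideal -> a * x \in left_ideal.
Proof.
case/memv_imgP=> y _ ->; rewrite !lfunE /= mulrA.
by rewrite -[a * y * e](_ : amulr e (a * y) = _) ?memv_img ?memvf // lfunE.
Qed.

Lemma mem_left_ideal : e \in left_ideal.
Proof.
by rewrite -[e in e \in _](_ : amulr e 1 = _) ?memv_img ?memvf // lfunE /= mul1r.
Qed.

Definition left_ideal_act (a : B) : 'End(subvs_of left_ideal) :=
  linfun (fun x => vsproj left_ideal (a * vsval x)).

Lemma left_ideal_actE a x : vsval (left_ideal_act a x) = a * vsval x.
Proof.
have lin : linear (fun x : subvs_of left_ideal =>
      vsproj left_ideal (a * vsval x)).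
  move=> c u v; have -> : vsval (c *: u + v) = c *: vsval u + vsval v by [].
  by rewrite mulrDr -scalerAr linearP.
rewrite /left_ideal_act (lfun_linE lin) vsprojK // left_idealM //.
exact: subvsP.
Qed.

Lemma left_ideal_act_linear : linear left_ideal_act.
Proof.
move=> c a b; apply/lfunP => x; apply: subvs_inj.
rewrite add_lfunE scale_lfunE [RHS]linearP /= !left_ideal_actE.
by rewrite mulrDl scalerAl.
Qed.

Lemma left_ideal_act1 : linfun left_ideal_act 1 = \1%VF.
Proof.
apply/lfunP => x; apply: subvs_inj.
by rewrite (lfun_linE left_ideal_act_linear) left_ideal_actE mul1r id_lfunE.
Qed.

Lemma left_ideal_actM (a b : B) :
  linfun left_ideal_act (a * b) =
  (linfun left_ideal_act a \o linfun left_ideal_act b)%VF.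
Proof.
apply/lfunP => x; apply: subvs_inj.
by rewrite comp_lfunE !(lfun_linE left_ideal_act_linear) !left_ideal_actE mulrA.
Qed.

Definition left_ideal_mod : amod := AMod left_ideal_act1 left_ideal_actM.

Definition left_ideal_gen : left_ideal_mod := vsproj left_ideal e.
End LeftIdeal.

Section Power.
Variables (n : nat) (X : amod).

Definition pow_act (a : B) : 'End({ffun 'I_n -> X}) :=
  linfun (fun x : {ffun 'I_n -> X} => [ffun i => act X a (x i)]).

Lemma pow_actE a x i : pow_act a x i = act X a (x i).
Proof.
have lin : linear (fun x : {ffun 'I_n -> X} => [ffun i => act X a (x i)]).
  by move=> c u v; apply/ffunP => j; rewrite !ffunE linearP.
by rewrite /pow_act (lfun_linE lin) ffunE.
Qed.

Lemma pow_act_linear : linear pow_act.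
Proof.
move=> c a b; apply/lfunP => x; apply/ffunP => i.
rewrite add_lfunE scale_lfunE !ffunE !pow_actE linearP.
by rewrite add_lfunE scale_lfunE.
Qed.

Lemma pow_act1 : linfun pow_act 1 = \1%VF.
Proof.
apply/lfunP => x; apply/ffunP => i.
by rewrite (lfun_linE pow_act_linear) pow_actE act1 !id_lfunE.
Qed.

Lemma pow_actM (a b : B) :
  linfun pow_act (a * b) = (linfun pow_act a \o linfun pow_act b)%VF.
Proof.
apply/lfunP => x; apply/ffunP => i.
by rewrite comp_lfunE !(lfun_linE pow_act_linear) !pow_actE actM comp_lfunE.
Qed.

Definition pow_mod : amod := AMod pow_act1 pow_actM.
End Power.

End Modules.

(* Pivotal quasi-Hopf data: the part of the structure that enters the         *)
(* definitions of tensor products, duals, (co)evaluations and associators.    *)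
(* Coassociativity, pentagon, antipode and pivotality axioms are not fields:  *)
(* for the algebras considered here all the data are prescribed by explicit   *)
(* formulas.                                                                  *)
Section QuasiHopf.
Variable F : fieldType.

Definition tmul (A B : falgType F) (x y : tens A B) : tens A B :=
  tlift (fun a b => tlift (fun a' b' => pure (a * a') (b * b')) y) x.

Record qHopf := QHopf {
  alg :> falgType F;
  Delta : 'Hom(alg, tens alg alg);
  Delta1 : Delta 1 = pure 1 1;
  DeltaM : forall a b : alg, Delta (a * b) = tmul (Delta a) (Delta b);
  eps : 'Hom(alg, F^o);
  eps1 : eps 1 = 1;
  epsM : forall a b : alg, eps (a * b) = (eps a : F) * eps b;
  antip : 'End(alg);
  antip1 : antip 1 = 1;
  antipM : forall a b : alg, antip (a * b) = antip b * antip a;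
  Phi : tens (tens alg alg) alg;
  Phi_inv : tens (tens alg alg) alg;
  evel : alg;
  coevel : alg;
  pivot : alg }.

Section TensorAction.
Variable B : falgType F.
Implicit Types V W : amod B.

Definition tact V W : 'Hom(tens B B, 'End(tens V W)) :=
  tlift (fun a b => tmap (act V a) (act W b)).

Definition tact3 U V W :
    'Hom(tens (tens B B) B, 'End(tens (tens (carrier U) V) (carrier W))) :=
  tlift (fun x c => tmap (tact U V x) (act W c)).

Lemma tmap_linl V V' W W' (g : 'Hom(W, W')) :
  linear (fun f : 'Hom(V, V') => @tmap F V W V' W' f g).
Proof.
move=> c f f'; apply: tens_ext => v w.
by rewrite add_lfunE scale_lfunE !tmapE add_lfunE scale_lfunE pure_linl.
Qed.

Lemma tmap_linr V V' W W' (f : 'Hom(V, V')) :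
  linear (fun g : 'Hom(W, W') => @tmap F V W V' W' f g).
Proof.
move=> c g g'; apply: tens_ext => v w.
by rewrite add_lfunE scale_lfunE !tmapE add_lfunE scale_lfunE pure_linr.
Qed.

Lemma tactE V W a b : tact V W (pure a b) = tmap (act V a) (act W b).
Proof.
rewrite /tact tliftE // => [b'|a'] c x y; rewrite linearP.
  exact: tmap_linl.
exact: tmap_linr.
Qed.

Lemma tmul_pureL (a b : B) y :
  tmul (pure a b) y = tlift (fun a' b' => pure (a * a') (b * b')) y.
Proof.
rewrite /tmul tliftE // => [w|v] c u u'; elim/tens_ind: y => [d x y Hx Hy|s t].
- by rewrite !linearP /= Hx Hy !scalerDr !scalerA [d * c]mulrC addrACA.
- rewrite !tliftE; last 6 first.
  all: try by move=> z k p q; rewrite mulrDr -scalerAr ?pure_linl ?pure_linr.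
  by rewrite mulrDl -scalerAl pure_linl.
- by rewrite !linearP /= Hx Hy !scalerDr !scalerA [d * c]mulrC addrACA.
rewrite !tliftE; last 6 first.
all: try by move=> z k p q; rewrite mulrDr -scalerAr ?pure_linl ?pure_linr.
by rewrite mulrDl -scalerAl pure_linr.
Qed.

Lemma tmulE (a b a' b' : B) :
  tmul (pure a b) (pure a' b') = pure (a * a') (b * b').
Proof.
rewrite tmul_pureL tliftE // => [w|v] c u u'; rewrite mulrDr -scalerAr.
  exact: pure_linl.
exact: pure_linr.
Qed.

Lemma tactM V W (x y : tens B B) :
  tact V W (tmul x y) = (tact V W x \o tact V W y)%VF.
Proof.
elim/tens_ind: x => [c x x' Hx Hx'|a b].
  have -> : tmul (c *: x + x') y = c *: tmul x y + tmul x' y.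
    by rewrite /tmul linearP.
  by rewrite !linearP /= Hx Hx' comp_lfunDl comp_lfunZl.
elim/tens_ind: y => [c y y' Hy Hy'|a' b'].
  have -> : tmul (pure a b) (c *: y + y') =
      c *: tmul (pure a b) y + tmul (pure a b) y'.
    by rewrite !tmul_pureL linearP.
  by rewrite !linearP /= Hy Hy' comp_lfunDr comp_lfunZr.
rewrite tmulE !tactE; apply: tens_ext => v w.
by rewrite comp_lfunE !tmapE !actM !comp_lfunE.
Qed.

Lemma tact1 V W : tact V W (pure 1 1) = \1%VF.
Proof.
rewrite tactE; apply: tens_ext => v w.
by rewrite tmapE !act1 !id_lfunE.
Qed.

End TensorAction.

Section ModCat.
Variable H : qHopf.
Implicit Types U V W : amod H.

Definition unit_act (a : H) : 'End(F^o) := (eps H a : F) *: \1%VF.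

Lemma unit_act_linear : linear unit_act.
Proof. by move=> c a b; rewrite /unit_act linearP /= scalerDl scalerA. Qed.

Lemma unit_mod1 : linfun unit_act 1 = \1%VF.
Proof. by rewrite (lfun_linE unit_act_linear) /unit_act eps1 scale1r. Qed.

Lemma unit_modM (a b : H) :
  linfun unit_act (a * b) = (linfun unit_act a \o linfun unit_act b)%VF.
Proof.
rewrite !(lfun_linE unit_act_linear) /unit_act epsM -comp_lfunZl -comp_lfunZr comp_lfun1l.
by rewrite scalerA.
Qed.

Definition unit_mod : amod H := AMod unit_mod1 unit_modM.

Lemma tens_mod1 V W : (tact V W \o Delta H)%VF 1 = \1%VF.
Proof. by rewrite comp_lfunE Delta1 tact1. Qed.

Lemma tens_modM V W (a b : H) :
  (tact V W \o Delta H)%VF (a * b) =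
  ((tact V W \o Delta H)%VF a \o (tact V W \o Delta H)%VF b)%VF.
Proof. by rewrite !comp_lfunE DeltaM tactM. Qed.

Definition tens_mod V W : amod H := AMod (tens_mod1 V W) (@tens_modM V W).

Definition dual_act V (a : H) : 'End(dual V) :=
  linfun (fun f : 'Hom(V, F^o) => (f \o act V (antip H a))%VF : dual V).

Lemma dual_actE V a (f : 'Hom(V, F^o)) :
  dual_act V a (f : dual V) = (f \o act V (antip H a))%VF.
Proof.
rewrite /dual_act (@lfun_linE F (dual V) (dual V)) // => c g g'.
by rewrite comp_lfunDl comp_lfunZl.
Qed.

Lemma dual_act_linear V : linear (dual_act V).
Proof.
move=> c a b; apply/lfunP => f; rewrite add_lfunE scale_lfunE !dual_actE.
by rewrite !linearP /= comp_lfunDr comp_lfunZr.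
Qed.

Lemma dual_mod1 V : linfun (dual_act V) 1 = \1%VF.
Proof.
rewrite (lfun_linE (@dual_act_linear V)); apply/lfunP => f.
by rewrite dual_actE antip1 act1 comp_lfun1r id_lfunE.
Qed.

Lemma dual_modM V (a b : H) :
  linfun (dual_act V) (a * b) =
  (linfun (dual_act V) a \o linfun (dual_act V) b)%VF.
Proof.
rewrite !(lfun_linE (@dual_act_linear V)); apply/lfunP => f.
by rewrite comp_lfunE !dual_actE antipM actM comp_lfunA.
Qed.

Definition dual_mod V : amod H := AMod (dual_mod1 V) (@dual_modM V).

Definition lunit V : 'Hom(tens_mod unit_mod V, V) :=
  tlift (fun (c : F^o) v => (c : F) *: v).
Definition lunit_inv V : 'Hom(V, tens_mod unit_mod V) :=
  linfun (fun v : V => pure (1 : F^o) v).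
Definition runit V : 'Hom(tens_mod V unit_mod, V) :=
  tlift (fun v (c : F^o) => (c : F) *: v).
Definition runit_inv V : 'Hom(V, tens_mod V unit_mod) :=
  linfun (fun v : V => pure v (1 : F^o)).

Definition assoc U V W :
    'Hom(tens_mod U (tens_mod V W), tens_mod (tens_mod U V) W) :=
  (tact3 U V W (Phi H) \o rebracket U V W)%VF.
Definition assoc_inv U V W :
    'Hom(tens_mod (tens_mod U V) W, tens_mod U (tens_mod V W)) :=
  (unbracket U V W \o tact3 U V W (Phi_inv H))%VF.

Definition ev V : 'Hom(tens_mod (dual_mod V) V, unit_mod) :=
  tlift (fun (f : 'Hom(V, F^o)) v => f (act V (evel H) v)).
Definition coev V : 'Hom(unit_mod, tens_mod V (dual_mod V)) :=
  linfun (fun c : F^o => (c : F) *: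
    \sum_i pure (act V (coevel H) (bvec i)) (bcovec i : dual V)).
Definition evr V : 'Hom(tens_mod V (dual_mod V), unit_mod) :=
  tlift (fun v (f : 'Hom(V, F^o)) =>
    f (act V (antip H (evel H) * pivot H) v)).
Definition coevr V : 'Hom(unit_mod, tens_mod (dual_mod V) V) :=
  linfun (fun c : F^o => (c : F) *:
    \sum_i pure (bcovec i : dual V)
      (act V ((antip H)^-1%VF (pivot H * coevel H)) (bvec i))).

Definition rptrace X V (f : 'End(tens_mod X V)) : 'End(carrier X) :=
  (runit X \o tmap \1 (evr V) \o assoc_inv X V (dual_mod V)
    \o tmap f \1 \o assoc X V (dual_mod V) \o tmap \1 (coev V)
    \o runit_inv X)%VF.

(* A right modified trace on the ideal of projective modules; the value of    *)
(* [t] is only relevant on module endomorphisms of projective modules.        *)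
Record right_modified_trace (t : forall X : amod H, 'End(X) -> F) : Prop := {
  mtr_linear : forall (X : amod H) (c : F) (f g : 'End(X)),
    aprojective X -> @amorph _ _ X X f -> @amorph _ _ X X g ->
    t X (c *: f + g) = c * t X f + t X g;
  mtr_cyclic : forall (X Y : amod H) (f : 'Hom(X, Y)) (g : 'Hom(Y, X)),
    aprojective X -> aprojective Y -> amorph f -> amorph g ->
    t X (g \o f)%VF = t Y (f \o g)%VF;
  mtr_partial : forall (X V : amod H) (f : 'End(tens_mod X V)),
    aprojective X -> amorph f -> t (tens_mod X V) f = t X (rptrace f) }.

End ModCat.

Record subqHopf (A H : qHopf) := SubqHopf {
  incl :> 'Hom(A, H);
  incl_inj : injective incl;
  incl1 : incl 1 = 1;
  inclM : forall a b : A, incl (a * b) = incl a * incl b;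
  incl_Delta : forall a : A, tmap incl incl (Delta A a) = Delta H (incl a);
  incl_eps : forall a : A, eps H (incl a) = eps A a;
  incl_antip : forall a : A, incl (antip A a) = antip H (incl a);
  incl_Phi : tmap (tmap incl incl) incl (Phi A) = Phi H;
  incl_Phi_inv : tmap (tmap incl incl) incl (Phi_inv A) = Phi_inv H;
  incl_evel : incl (evel A) = evel H;
  incl_coevel : incl (coevel A) = coevel H;
  incl_pivot : incl (pivot A) = pivot H }.

Section Restriction.
Variables (A H : qHopf) (inc : subqHopf A H) (M : amod H).

Lemma res_mod1 : (act M \o inc)%VF 1 = \1%VF.
Proof. by rewrite comp_lfunE incl1 act1. Qed.

Lemma res_modM (a b : A) :
  (act M \o inc)%VF (a * b) =
  ((act M \o inc)%VF a \o (act M \o inc)%VF b)%VF.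
Proof. by rewrite !comp_lfunE inclM actM. Qed.

Definition res_mod : amod A := AMod res_mod1 res_modM.

Definition in_ideal : Prop := aprojective res_mod.
End Restriction.

Record rqHopf := RqHopf {
  rqH :> qHopf;
  Rmat : tens rqH rqH;
  ribbon : rqH }.

Section Ribbon.
Variable H : rqHopf.
Implicit Types U V W X : amod H.

(* x (x) y |-> R_2 y (x) R_1 x *)
Definition braiding V W : 'Hom(tens_mod V W, tens_mod W V) :=
  tlift (fun x y =>
    tlift (fun r1 r2 => pure (act W r2 y) (act V r1 x)) (Rmat H)).

Definition twist V : 'End(carrier V) := act V (ribbon H)^-1.

(* Diagrams of ribbon graphs coloured by H-modules, as morphisms of the       *)
(* ribbon category generated by coloured oriented points: [wpt X] and         *)
(* [wdual X] are points coloured by X with the two orientations.              *)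
Inductive word :=
  | wunit | wpt of amod H | wdual of amod H | wtens of word & word.

Fixpoint wmod (w : word) : amod H :=
  match w with
  | wunit => unit_mod H
  | wpt X => X
  | wdual X => dual_mod X
  | wtens u v => tens_mod (wmod u) (wmod v)
  end.

Inductive rgraph : word -> word -> Type :=
  | gid u : rgraph u u
  | gcomp u v w : rgraph v w -> rgraph u v -> rgraph u w
  | gtens u v u' v' : rgraph u u' -> rgraph v v' ->
      rgraph (wtens u v) (wtens u' v')
  | gassoc u v w : rgraph (wtens u (wtens v w)) (wtens (wtens u v) w)
  | gassoc_inv u v w : rgraph (wtens (wtens u v) w) (wtens u (wtens v w))
  | glunit u : rgraph (wtens wunit u) u
  | glunit_inv u : rgraph u (wtens wunit u)
  | grunit u : rgraph (wtens u wunit) u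
  | grunit_inv u : rgraph u (wtens u wunit)
  | gbraid u v : rgraph (wtens u v) (wtens v u)
  | gbraid_inv u v : rgraph (wtens v u) (wtens u v)
  | gtwist u : rgraph u u
  | gtwist_inv u : rgraph u u
  | gev X : rgraph (wtens (wdual X) (wpt X)) wunit
  | gcoev X : rgraph wunit (wtens (wpt X) (wdual X))
  | gevr X : rgraph (wtens (wpt X) (wdual X)) wunit
  | gcoevr X : rgraph wunit (wtens (wdual X) (wpt X))
  | gcoupon u v (f : 'Hom(wmod u, wmod v)) of amorph f : rgraph u v.

Fixpoint RT u v (T : rgraph u v) : 'Hom(wmod u, wmod v) :=
  match T in rgraph u v return 'Hom(wmod u, wmod v) with
  | gid u => \1%VF
  | gcomp _ _ _ T1 T2 => (RT T1 \o RT T2)%VF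
  | gtens _ _ _ _ T1 T2 => tmap (RT T1) (RT T2)
  | gassoc u v w => assoc (wmod u) (wmod v) (wmod w)
  | gassoc_inv u v w => assoc_inv (wmod u) (wmod v) (wmod w)
  | glunit u => lunit (wmod u)
  | glunit_inv u => lunit_inv (wmod u)
  | grunit u => runit (wmod u)
  | grunit_inv u => runit_inv (wmod u)
  | gbraid u v => braiding (wmod u) (wmod v)
  | gbraid_inv u v => (braiding (wmod u) (wmod v))^-1%VF
  | gtwist u => twist (wmod u)
  | gtwist_inv u => (twist (wmod u))^-1%VF
  | gev X => ev X
  | gcoev X => coev X
  | gevr X => evr X
  | gcoevr X => coevr X
  | gcoupon _ _ f _ => f
  end.

Definition gpow u (T T' : rgraph u u) (n : int) : rgraph u u :=
  match n with
  | Posz k => iter k (gcomp T) (gid u)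
  | Negz k => iter k.+1 (gcomp T') (gid u)
  end.

Definition gclose_right X Y (T : rgraph (wtens (wpt X) (wpt Y))
                                        (wtens (wpt X) (wpt Y))) :
    rgraph (wpt X) (wpt X) :=
  gcomp (grunit (wpt X)) (gcomp (gtens (gid (wpt X)) (gevr Y))
    (gcomp (gassoc_inv (wpt X) (wpt Y) (wdual Y))
      (gcomp (gtens T (gid (wdual Y)))
        (gcomp (gassoc (wpt X) (wpt Y) (wdual Y))
          (gcomp (gtens (gid (wpt X)) (gcoev Y)) (grunit_inv (wpt X))))))).

Definition gclose X (T : rgraph (wpt X) (wpt X)) : rgraph wunit wunit :=
  gcomp (gevr X) (gcomp (gtens T (gid (wdual X))) (gcoev X)).

(* A closed ribbon graph presented as the closure of its cutting [cut] at an  *)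
(* edge coloured by [edge].                                                   *)
Record cut_graph := CutGraph {
  edge : amod H;
  cut : rgraph (wpt edge) (wpt edge) }.

Definition underlying_graph (T : cut_graph) : rgraph wunit wunit :=
  gclose (cut T).

Definition renormalised (t : forall X : amod H, 'End(X) -> F)
    (T : cut_graph) : F :=
  t (edge T) (RT (cut T)).

Definition unknot (n : int) X : cut_graph :=
  CutGraph (gpow (gtwist (wpt X)) (gtwist_inv (wpt X)) n).

(* The closure of c_{X,X}^m, cut at its left strand.                          *)
Definition torus (m : int) X : cut_graph :=
  CutGraph (gclose_right
    (gpow (gbraid (wpt X) (wpt X)) (gbraid_inv (wpt X) (wpt X)) m)).

(* The closure of (theta_X^a (x) theta_U^b) c_{U,X} c_{X,U}, cut at X.        *)
Definition hopf_link X (a : int) U (b : int) : cut_graph :=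
  CutGraph (gclose_right
    (gcomp (gtens (gpow (gtwist (wpt X)) (gtwist_inv (wpt X)) a)
                  (gpow (gtwist (wpt U)) (gtwist_inv (wpt U)) b))
      (gcomp (gbraid (wpt U) (wpt X)) (gbraid (wpt X) (wpt U))))).

End Ribbon.
End QuasiHopf.

(* The symplectic fermion algebra Q(2, beta) with generators K and f_i^s,     *)
(* where i : 'I_2 and the sign s is true for + and false for -.               *)
Section SymplecticFermions.
Variable C : numClosedFieldType.

Definition sgn (s : bool) : C := if s then 1 else -1.

Definition e0 (B : algType C) (K : B) : B := 2^-1 *: (1 + K ^+ 2).
Definition e1 (B : algType C) (K : B) : B := 2^-1 *: (1 - K ^+ 2).
Definition e_ (B : algType C) (K : B) (n : 'I_2) : B :=
  if n == ord0 then e0 K else e1 K.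

Record sf_relations (B : algType C) (K : B) (f : 'I_2 -> bool -> B) : Prop := {
  rel_fK : forall i s, f i s * K + K * f i s = 0;
  rel_fpfm : forall i j,
    f i true * f j false + f j false * f i true = (i == j)%:R *: e1 K;
  rel_ff : forall i j s, f i s * f j s + f j s * f i s = 0;
  rel_K4 : K ^+ 4 = 1 }.

Definition sf_presented (B : algType C) (K : B) (f : 'I_2 -> bool -> B) : Prop :=
  sf_relations K f /\
  forall (B' : algType C) (K' : B') (f' : 'I_2 -> bool -> B'),
    sf_relations K' f' ->
    exists phi : {lrmorphism B -> B'},
      (phi K = K' /\ forall i s, phi (f i s) = f' i s) /\
      forall psi : {lrmorphism B -> B'},
        psi K = K' -> (forall i s, psi (f i s) = f' i s) -> psi =1 phi.

Section Elements.
Variables (H : falgType C) (K : H) (f : 'I_2 -> bool -> H) (beta : C).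

Definition omega (s : bool) : H := (e0 K + (sgn s * 'i) *: e1 K) * K.

Definition bbeta (s : bool) : H :=
  e0 K + beta ^+ 2 *: (((sgn s * 'i) *: K) ^+ 2 * e1 K).

Definition sf_Phi (s : bool) : tens (tens H H) H :=
  pure (pure 1 1 : tens H H) 1
  + pure (pure (e1 K) (e1 K) : tens H H)
         (e0 K * (K ^+ 2 - 1) + e1 K * (bbeta s - 1)).

Definition rho (n m : 'I_2) : tens H H :=
  2^-1 *: \sum_(k < 2) \sum_(l < 2)
    ((-1) ^+ (k * l) * 'i ^ ((l * m)%N%:Z - (k * n)%N%:Z))
      *: pure (K ^+ k) (K ^+ l).

Definition sf_R : tens H H :=
  tmul (\sum_(n < 2) \sum_(m < 2)
          beta ^+ (n * m) *: tmul (rho n m) (pure (e_ K n) (e_ K m)))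
       (\big[@tmul C H H / pure 1 1]_(j < 2)
          (pure 1 1 - 2 *: pure (f j false * omega false) (f j true))).

Definition fermion_parity : H :=
  \prod_(j < 2) (1 - 2 *: (f j true * f j false)).

Definition sf_ribbon : H := (e0 K - (beta * 'i) *: (K * e1 K)) * fermion_parity.

Definition sf_pivot : H := (e0 K + (- 'i) ^+ 3 *: (e1 K * K ^+ 2)) * K.

Definition e1pm (s : bool) : H :=
  2^-1 *: (e1 K * (1 - (sgn s * 'i) *: (K * fermion_parity))).

End Elements.

Record symplectic_fermions (H : rqHopf C) (K : H) (f : 'I_2 -> bool -> H)
    (beta : C) : Prop := {
  sf_pres : sf_presented K f;
  sf_DeltaK : Delta H K = pure K K - 2 *: pure (e1 K * K) (e1 K * K);
  sf_Deltaf : forall i s,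
    Delta H (f i s) = pure (f i s) 1 + pure (omega K s) (f i s);
  sf_epsK : eps H K = 1;
  sf_epsf : forall i s, eps H (f i s) = 0;
  sf_PhiE : Phi H = sf_Phi K beta true;
  sf_Phi_invE : Phi_inv H = sf_Phi K beta false;
  sf_antipK : antip H K = K;
  sf_antipf : forall i s,
    antip H (f i s) = f i s * (e0 K + (sgn s * 'i) *: e1 K) * K;
  sf_evelE : evel H = 1;
  sf_coevelE : coevel H = bbeta K beta true;
  sf_pivotE : pivot H = sf_pivot K;
  sf_RE : Rmat H = sf_R K f beta;
  sf_ribbonE : ribbon H = sf_ribbon K f beta }.

(* The image of A is the subalgebra generated by K, f_1^+ and f_1^-. *)
Definition first_fermion (H : qHopf C) (K : H) (f : 'I_2 -> bool -> H)
    (A : qHopf C) (inc : subqHopf A H) : Prop :=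
  limg (incl inc) = agenv <<[:: K; f ord0 true; f ord0 false]>>%VS.

Definition sf_lambda (H : qHopf C) (K : H) (f : 'I_2 -> bool -> H) (beta : C)
    (A : qHopf C) (inc : subqHopf A H) (lam : 'Hom(A, C^o)) : Prop :=
  forall (a : A) (s t : 'I_2) (m : 'I_4),
    inc a = f ord0 true ^+ s * f ord0 false ^+ t * K ^+ m ->
    lam a = if (s == 1%N :> nat) && (t == 1%N :> nat)
            then (m == 1%N :> nat)%:R - 'i * beta ^+ 2 * (m == 3%N :> nat)%:R
            else 0.

(* t_{Ae}(f) = lam(f(e)) for idempotents e. *)
Definition trace_from_form (A : qHopf C) (lam : 'Hom(A, C^o))
    (t : forall X : amod A, 'End(X) -> C) : Prop :=
  forall (e : A) (g : 'End(carrier (left_ideal_mod e))),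
    e * e = e -> @amorph _ _ (left_ideal_mod e) (left_ideal_mod e) g ->
    t (left_ideal_mod e) g = lam (vsval (g (left_ideal_gen e))).

Definition ideal_trace (beta : C) (A H : qHopf C) (inc : subqHopf A H)
    (t : forall X : amod A, 'End(X) -> C) (M : amod H) (g : 'End(M)) : C :=
  4 / (1 - 'i * beta ^+ 2) * t (res_mod inc M) g.

Definition is_P (H : qHopf C) (K : H) (f : 'I_2 -> bool -> H)
    (mu : 'M[C]_2) (P : amod H) : Prop :=
  exists v0 : P,
    [/\ basis_of {:P}
          [:: v0; act P (f ord0 true) v0; act P (f ord0 false) v0;
              act P (f ord0 true) (act P (f ord0 false) v0)],
        act P K v0 = v0 &
        (* mu = [a^- a^+; b^- b^+] *)
        forall s : bool, act P (f ord_max s) =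
          mu ord0 (if s then ord_max else ord0) *: act P (f ord0 false)
          + mu ord_max (if s then ord_max else ord0) *: act P (f ord0 true)].

Definition is_X0 (H : qHopf C) (K : H) (f : 'I_2 -> bool -> H)
    (s : bool) (X : amod H) : Prop :=
  [/\ \dim {:X} = 1%N, act X K = sgn s *: \1%VF &
      forall i t, act X (f i t) = 0].

Definition is_X1 (H : qHopf C) (K : H) (f : 'I_2 -> bool -> H)
    (s : bool) (X : amod H) : Prop :=
  [/\ \dim {:X} = 4%N, asimple X, aprojective X &
      aiso (left_ideal_mod (e1pm K f s)) (pow_mod 4 X)].

End SymplecticFermions.

(* Main.v *)
(* On P_mu one has K^2 = 1 and e_1 = 0, so the associators are trivial, the   *)
(* partial trace is the plain one with pivot K, and every invariant is read   *)
(* off an operator 1 + t f_1^+ f_1^-. The A-module P_mu is the module A e of  *)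
(* the idempotent e = (1 + K + K^2 + K^3) / 4, and the form defining the trace *)
(* picks out t.                                                               *)
(* With D = 1 + det mu, the twist is 1 + 2 D f_1^+ f_1^-. The R-matrix is a   *)
(* parity sign times an exponential of fermion bilinears, and these           *)
(* exponentials compose additively: the square of the self-braiding c is      *)
(* W(1) for a one-parameter group W, so c^(2j+1) = c W(j), whose partial trace *)
(* is linear in j. The monodromy with X_0 is trivial; that with X_1 is K (x) 1 *)
(* times bilinears f K (x) f', and the partial trace vanishes because tr K,   *)
(* tr (K f) and tr (K f f') vanish on X_1 and products of three fermions      *)
(* vanish on P_mu.                                                            *)
From HB Require Import structures.
Require Import Defs.
From mathcomp Require Import all_boot all_order all_algebra all_field.
From mathcomp Require Import ring reals.
From mathcomp.real_closed Require Import complex.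

Set Implicit Arguments.
Unset Strict Implicit.
Unset Printing Implicit Defensive.

Import Order.TTheory GRing.Theory Num.Theory.
Local Open Scope ring_scope.

(** The generator of [P] is fixed by K, so K^2 = 1 and e_1 = 0 on [P]. There f_1^+ and f_1^- act as
    anticommuting operators x, y of square zero, and f_2^+, f_2^- as linear combinations of them.
    Every cut diagram of the theorem then evaluates to an operator c (1 + t x y), so what remains is
    the trace of such operators and the values of c and t.

    Trace. As an A-module [P] is universal on a vector fixed by K ([P_universal]), hence projective
    and a retract of A e for the idempotent e = [vacuum]. Cyclicity moves the trace to A e, where
    the form vanishes on e and equals (1 - i beta^2)/4 on f_1^+ f_1^- e ([tA_P]). The prefactor 4/(1
    - i beta^2) cancels this, leaving c t ([ideal_trace_unipotent]).

    Unknot and torus knot. Put D = 1 + det mu. Fermion parity is 1 - 2 D x y on [P], which gives the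
    twist 1 + 2 D x y and its powers ([RT_twist_P]). The self-braiding is a flip, a sign and an
    exponential of fermion bilinears. Conjugation by the signed flip negates the bilinears and
    exchanges their two slots, so the square is the value at 1 of a one-parameter group
    ([self_braid_sqr]). The power 2j+1 is thus the braiding times the group element at j, whose
    partial trace has t = 2 (2j+1) D ([flip_trace_self_braid], [RT_torus]).

    Hopf link. Fermions act by zero on X_0, the two signs of the double braiding cancel, and the
    closed component contributes the trace of the pivot ([RT_hopf_X0]). On X_1 one has K^2 = -1 and
    a scalar ribbon element, by centrality. The double braiding is K (x) 1 times four factors 1 - 2
    f K (x) f'. Each of the sixteen terms of its expansion dies: up to two fermions are traceless
    against the pivot on X_1, and three or more act by zero on [P] ([hopf_map_X1_null]). *)

Section TensorCalculus.
Variable F : fieldType.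
Implicit Types U V W Z : vectType F.

(** * Bilinearity, flips, traces and contractions of tensors *)

Lemma pureDl V W (v v' : V) (w : W) : pure (v + v') w = pure v w + pure v' w.
Proof. by have := pure_linl w 1 v v'; rewrite !scale1r. Qed.

Lemma pureDr V W (v : V) (w w' : W) : pure v (w + w') = pure v w + pure v w'.
Proof. by have := pure_linr v 1 w w'; rewrite !scale1r. Qed.

Lemma pure0l V W (w : W) : pure (0 : V) w = 0.
Proof. by apply: (addrI (pure (0 : V) w)); rewrite -pureDl !addr0. Qed.

Lemma pure0r V W (v : V) : pure v (0 : W) = 0.
Proof. by apply: (addrI (pure v (0 : W))); rewrite -pureDr !addr0. Qed.

Lemma pureZl V W c (v : V) (w : W) : pure (c *: v) w = c *: pure v w.
Proof. by have := pure_linl w c v 0; rewrite !addr0 pure0l addr0. Qed.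

Lemma pureZr V W c (v : V) (w : W) : pure v (c *: w) = c *: pure v w.
Proof. by have := pure_linr v c w 0; rewrite !addr0 pure0r addr0. Qed.

Lemma pureNl V W (v : V) (w : W) : pure (- v) w = - pure v w.
Proof. by rewrite -scaleN1r pureZl scaleN1r. Qed.

Lemma pureNr V W (v : V) (w : W) : pure v (- w) = - pure v w.
Proof. by rewrite -scaleN1r pureZr scaleN1r. Qed.

Definition pureE := (pureDl, pureDr, pureZl, pureZr, pureNl, pureNr,
  pure0l, pure0r).

Lemma eq_tlift V W Z (b b' : V -> W -> Z) :
  (forall v w, b v w = b' v w) -> tlift b = tlift b'.
Proof.
move=> bb'; apply: tens_ext => v w; rewrite !tlift_val.
by apply: eq_bigr => i _; apply: eq_bigr => j _; rewrite bb'.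
Qed.

Definition flip V W : 'Hom(tens V W, tens W V) := tlift (fun v w => pure w v).

Lemma flipE V W (v : V) (w : W) : flip V W (pure v w) = pure w v.
Proof.
by rewrite /flip tliftE // => [w'|v'] c x y; rewrite !pureE.
Qed.

Definition trc V (g : 'End(V)) : F := \sum_i bcovec i (g (bvec i)).

Lemma trcD V (g h : 'End(V)) : trc (g + h) = trc g + trc h.
Proof.
by rewrite /trc -big_split; apply: eq_bigr => i _; rewrite add_lfunE linearD.
Qed.

Lemma trcZ V c (g : 'End(V)) : trc (c *: g) = c * trc g.
Proof.
by rewrite /trc mulr_sumr; apply: eq_bigr => i _; rewrite scale_lfunE linearZ.
Qed.

Lemma trcN V (g : 'End(V)) : trc (- g) = - trc g.
Proof. by rewrite -scaleN1r trcZ mulN1r. Qed.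

Lemma trc_mulC V W (g : 'Hom(V, W)) (h : 'Hom(W, V)) :
  trc (g \o h)%VF = trc (h \o g)%VF.
Proof.
have E (V1 V2 : vectType F) (p : 'Hom(V1, V2)) (q : 'Hom(V2, V1)) :
    trc (q \o p)%VF = \sum_i \sum_j bcovec j (p (bvec i)) * bcovec i (q (bvec
      j)).
  apply: eq_bigr => i _; rewrite comp_lfunE {1}[p (bvec i)]bvec_sum !linear_sum.
  by apply: eq_bigr => j _; rewrite !linearZ.
rewrite !E exchange_big /=; apply: eq_bigr => i _; apply: eq_bigr => j _.
by rewrite mulrC.
Qed.

(** Contraction of the second tensor factor; summed over a basis it yields partial traces. *)
Definition slice V W (phi : 'Hom(W, F^o)) : 'Hom(tens V W, V) :=
  tlift (fun v w => (phi w : F) *: v).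

Lemma sliceE V W (phi : 'Hom(W, F^o)) (v : V) (w : W) :
  slice V phi (pure v w) = (phi w : F) *: v.
Proof.
rewrite /slice tliftE // => [w'|v'] c x y.
  by rewrite scalerDr !scalerA mulrC.
by rewrite linearP /= scalerDl scalerA.
Qed.

End TensorCalculus.

(** * Module actions on vectors *)

Section ModuleCalculus.
Variables (F : fieldType) (B : falgType F).
Implicit Types M N V W : amod B.

Lemma act1v M v : act M 1 v = v.
Proof. by rewrite act1 id_lfunE. Qed.

Lemma actMv M a b v : act M (a * b) v = act M a (act M b v).
Proof. by rewrite actM comp_lfunE. Qed.

Lemma actDv M a b v : act M (a + b) v = act M a v + act M b v.
Proof. by rewrite linearD add_lfunE. Qed.

Lemma actNv M a v : act M (- a) v = - act M a v.
Proof. by rewrite linearN opp_lfunE. Qed.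

Lemma actZv M c a v : act M (c *: a) v = c *: act M a v.
Proof. by rewrite linearZ scale_lfunE. Qed.

Lemma act0v M v : act M 0 v = 0.
Proof. by rewrite linear0 zero_lfunE. Qed.

Definition actE := (actMv, actDv, actNv, actZv, act0v, act1v).

Lemma amorphE M N (f : 'Hom(M, N)) : amorph f <->
  (forall a v, f (act M a v) = act N a (f v)).
Proof.
split=> [hf a v|hf a]; first by rewrite -!comp_lfunE hf.
by apply/lfunP => v; rewrite !comp_lfunE.
Qed.

Lemma tact_pure V W a b v w :
  tact V W (pure a b) (pure v w) = pure (act V a v) (act W b w).
Proof. by rewrite tactE tmapE. Qed.

Lemma tlift_flip V W (r : tens B B) v w :
  tlift (fun r1 r2 => pure (act W r2 w) (act V r1 v)) r =
  flip V W (tact V W r (pure v w)).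
Proof.
elim/tens_ind: r => [c x y Hx Hy|a b]; last first.
  rewrite tliftE ?tact_pure ?flipE // => [z|z] c x y.
    by rewrite !actE !pureE.
  by rewrite !actE !pureE.
by rewrite linearP /= Hx Hy [tact V W (_ + _)]linearP /= add_lfunE scale_lfunE
  linearP.
Qed.

End ModuleCalculus.

(** * Braidings and partial closures *)

Section Braid.
Variables (F : fieldType) (H : rqHopf F).
Implicit Types U X Y : amod H.
Implicit Types V W : amod H.

Lemma braiding_flip V W :
  braiding V W = (flip V W \o tact V W (Rmat H))%VF.
Proof.
apply: tens_ext => v w; rewrite comp_lfunE -tlift_flip.
rewrite /braiding (eq_tlift (fun v w => tlift_flip (V := V) (W := W) (Rmat H) v
  w)).
by rewrite tliftE ?tlift_flip // => [x|x] c y z; rewrite !pureE !linearP.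
Qed.

Lemma flipK V W : (flip V W \o flip W V)%VF = \1%VF.
Proof. by apply: tens_ext => v w; rewrite comp_lfunE !flipE id_lfunE. Qed.

Lemma runit_pure V (v : V) (c : F^o) :
  runit V (pure v c) = (c : F) *: v.
Proof.
rewrite /runit tliftE // => [w'|v'] d x y.
  by rewrite scalerDr !scalerA mulrC.
by rewrite scalerDl scalerA.
Qed.

Lemma evr_pure V (v : V) (phi : 'Hom(V, F^o)) :
  evr V (pure v (phi : dual V)) = phi (act V (antip H (evel H) * pivot H) v).
Proof.
rewrite /evr tliftE // => [w'|v'] d x y.
  by rewrite !linearP.
by rewrite add_lfunE scale_lfunE.
Qed.

Lemma coevE V (c : F^o) : coev V c = (c : F) *:
    \sum_i pure (act V (coevel H) (bvec i)) (bcovec i : dual V).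
Proof.
rewrite /coev lfun_linE // => d x y.
by rewrite scalerDl scalerA.
Qed.

Lemma runit_invE V (v : V) : runit_inv V v = pure v (1 : F^o).
Proof. by rewrite /runit_inv lfun_linE //; apply: pure_linl. Qed.

Definition Phi_trivial (X : amod H) := forall V W,
  tact3 X V W (Phi H) = \1%VF /\ tact3 X V W (Phi_inv H) = \1%VF.

(** With trivial associators the closure is an ordinary partial trace over Y; only the pivot and the
    coevaluation element, which may act nontrivially on Y, remain visible. *)
Lemma RT_gclose_right X Y
    (T : Defs.rgraph (wtens (wpt X) (wpt Y)) (wtens (wpt X) (wpt Y))) v :
  Phi_trivial X ->
  RT (gclose_right T) v = \sum_i slice X
     (bcovec i \o act Y (antip H (evel H) * pivot H))%VF
     (RT T (pure v (act Y (coevel H) (bvec i)))).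
Proof.
move=> PhiX; have [Phi1 Phi2] := PhiX Y (dual_mod Y).
rewrite /= !comp_lfunE runit_invE tmapE id_lfunE coevE scale1r.
rewrite (_ : pure v _ = \sum_i pure v (pure (act Y (coevel H) (bvec i)) (bcovec
  i : dual Y))).
  rewrite !linear_sum; apply: eq_bigr => i _ /=.
  rewrite rebracketE Phi1 id_lfunE tmapE id_lfunE.
  set t := RT T _; elim/tens_ind: t => [c x y Hx Hy|x y].
    by rewrite !pureE !linearP /= Hx Hy.
  rewrite Phi2 id_lfunE unbracketE tmapE id_lfunE.
  by rewrite runit_pure evr_pure sliceE comp_lfunE.
by elim/big_rec2: _ => [|i s t _ <-]; rewrite ?pure0r ?pureDr.
Qed.

End Braid.

(** * Linear identities reduced to scalar ones; inverses of endomorphisms *)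

Section LinearMaps.
Variables (F : fieldType) (V W : vectType F).
Implicit Types g : 'Hom(V, W).

Lemma lfD g v w : g (v + w) = g v + g w. Proof. exact: linearD. Qed.
Lemma lfN g v : g (- v) = - g v. Proof. exact: linearN. Qed.
Lemma lfZ g c v : g (c *: v) = c *: g v. Proof. exact: linearZ. Qed.
Lemma lf0 g : g 0 = 0. Proof. exact: linear0. Qed.
Lemma lf_sum g (I : Type) (r : seq I) (G : I -> V) :
  g (\sum_(i <- r) G i) = \sum_(i <- r) g (G i).
Proof. exact: linear_sum. Qed.

End LinearMaps.

Definition lfunOpE := (@comp_lfunE, @add_lfunE, @opp_lfunE, @scale_lfunE,
  @id_lfunE, @zero_lfunE).

Ltac push_linear := repeat (progress rewrite ?lfD ?lfN ?lfZ ?lf0).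

Section Coordinates.
Variables (F : fieldType) (W : vectType F).

Lemma vect_coordP (u v : W) : (forall i, bcovec i u = bcovec i v) -> u = v.
Proof.
by move=> uv; rewrite [u]bvec_sum [v]bvec_sum; apply: eq_bigr => i _; rewrite
  uv.
Qed.

Variable i : 'I_(\dim {:W}).
Definition bcoord (v : W) : F := bcovec i v.

Lemma bcoordD u v : bcoord (u + v) = bcoord u + bcoord v.
Proof. by rewrite /bcoord lfD. Qed.
Lemma bcoordN v : bcoord (- v) = - bcoord v.
Proof. by rewrite /bcoord lfN. Qed.
Lemma bcoordZ c v : bcoord (c *: v) = c * bcoord v.
Proof. by rewrite /bcoord lfZ. Qed.
Lemma bcoord0 : bcoord 0 = 0.
Proof. by rewrite /bcoord lf0. Qed.

End Coordinates.

Ltac coordinates :=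
  apply: vect_coordP => ?; rewrite -!/(bcoord _ _);
  repeat (progress rewrite ?bcoordD ?bcoordN ?bcoordZ ?bcoord0).
(* Pure tensors and the tensor space are generalized to variables before      *)
(* taking coordinates: otherwise unification unfolds tensors to matrices.     *)
Ltac tensor_coordinates :=
  repeat (progress rewrite ?opprK ?pureNl ?pureNr ?pure0l ?pure0r);
  repeat match goal with |- context [pure ?a ?b] => move: (pure a b) end;
  match goal with |- context [tens ?A ?B] => generalize (tens A B) end;
  intros;
  coordinates.

Section LfunIter.
Variables (F : fieldType) (V : vectType F).

Definition lfun_iter (c : 'End(V)) n : 'End(V) :=
  iter n (comp_lfun c) \1%VF.

(** [^-1] is a total operation on linear maps. A left inverse makes [c] injective, hence invertible
    in finite dimension, so that [^-1] is the true inverse. *)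
Lemma lfun_left_inv (c d : 'End(V)) :
  (d \o c)%VF = \1%VF -> (c^-1)%VF = d.
Proof.
move=> dc; have c0 : lker c == 0%VS.
  by apply/lker0P/(can_inj (g := d)) => v; rewrite -comp_lfunE dc id_lfunE.
by rewrite -[d]comp_lfun1r -(lker0_compfV c0) comp_lfunA dc comp_lfun1l.
Qed.

Lemma lfun_left_inv_comp (c d : 'End(V)) :
  (d \o c)%VF = \1%VF -> (c \o d)%VF = \1%VF.
Proof.
move=> dc; have c0 : lker c == 0%VS.
  by apply/lker0P/(can_inj (g := d)) => v; rewrite -comp_lfunE dc id_lfunE.
by rewrite -(lfun_left_inv dc) lker0_compfV.
Qed.

End LfunIter.

(* The braiding of P_mu with itself, as an operator built from the action k   *)
(* of K and the actions x, y of f_1^+, f_1^-.                                 *)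
Section SelfBraiding.
Variables (C : numFieldType) (V : vectType C) (k x y : 'End(V)).
Hypotheses (kk : forall v, k (k v) = v)
  (xk : forall v, x (k v) = - k (x v)) (yk : forall v, y (k v) = - k (y v))
  (xx : forall v, x (x v) = 0) (yy : forall v, y (y v) = 0)
  (yx : forall v, y (x v) = - x (y v)).

Ltac normalize := repeat (progress
  rewrite ?xk ?yk ?lfD ?lfZ ?lfN ?kk ?xx ?yy ?yx ?lfN ?lf0 ?opprK).

(** The Koszul sign of the grading by [k]: -1 on the product of the two (-1)-eigenspaces, +1 on the
    other three products. *)
Definition half_parity : 'End(tens V V) :=
  2^-1 *: (\1 + tmap k \1 + tmap \1 k - tmap k k)%VF.

(** The shape of an exponential of bilinears in x, y: products of three bilinears vanish, and every
    product of two is a multiple of xy (x) xy. It is a true exponential when z = 4 (pq - rs). *)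
Definition gauss (p q r s z : C) : 'End(tens V V) :=
  (\1 - 2 *: (p *: tmap (y \o k) x + q *: tmap (x \o k) y
             + r *: tmap (y \o k) y + s *: tmap (x \o k) x)
     + z *: tmap (x \o y) (x \o y))%VF.

Lemma half_parityE v w : half_parity (pure v w) =
  2^-1 *: (pure v w + pure (k v) w + pure v (k w) - pure (k v) (k w)).
Proof. by rewrite /half_parity !lfunOpE !tmapE !id_lfunE. Qed.

Lemma gauss_apply p q r s z t : gauss p q r s z t =
  t - 2 *: (p *: tmap (y \o k) x t + q *: tmap (x \o k) y t
             + r *: tmap (y \o k) y t + s *: tmap (x \o k) x t)
     + z *: tmap (x \o y) (x \o y) t.
Proof. by rewrite /gauss !lfunOpE. Qed.

Lemma gaussE p q r s z v w : gauss p q r s z (pure v w) =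
  pure v w - 2 *: (p *: pure (y (k v)) (x w) + q *: pure (x (k v)) (y w)
             + r *: pure (y (k v)) (y w) + s *: pure (x (k v)) (x w))
     + z *: pure (x (y v)) (x (y w)).
Proof. by rewrite gauss_apply !tmapE !comp_lfunE. Qed.

Lemma eq_gauss p q r s z p' q' r' s' z' :
  p = p' -> q = q' -> r = r' -> s = s' -> z = z' ->
  gauss p q r s z = gauss p' q' r' s' z'.
Proof. by move=> -> -> -> -> ->. Qed.

(** The bilinears commute, so their coefficients add; the correction to z is the polarisation of the
    quadratic form 4 (pq - rs). *)
Lemma gauss_comp p q r s z p' q' r' s' z' :
  (gauss p q r s z \o gauss p' q' r' s' z')%VF =
  gauss (p + p') (q + q') (r + r') (s + s')
        (z + z' + 4 * (p * q' + q * p' - r * s' - s * r')).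
Proof.
apply: tens_ext => v w; rewrite comp_lfunE !gaussE; push_linear; rewrite
  !gaussE; normalize.
by tensor_coordinates; ring.
Qed.

Lemma half_parityK : (half_parity \o half_parity)%VF = \1%VF.
Proof.
apply: tens_ext => v w; rewrite !comp_lfunE !half_parityE; push_linear; rewrite
  !half_parityE.
by rewrite id_lfunE !kk; tensor_coordinates; field.
Qed.

Lemma half_parity_flip :
  (half_parity \o flip V V)%VF = (flip V V \o half_parity)%VF.
Proof.
apply: tens_ext => v w; rewrite !comp_lfunE flipE !half_parityE; push_linear;
  rewrite !flipE.
by tensor_coordinates; ring.
Qed.

(** An odd operator in one slot changes the Koszul sign by the parity of the other slot; for a pair
    of odd operators this carries [k] from the left slot to the right. *)
Lemma half_parity_odd (A B : 'End(V)) v w :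
  (forall v, A (k v) = - k (A v)) -> (forall v, B (k v) = - k (B v)) ->
  half_parity (tmap (A \o k) B (half_parity (pure v w))) =
  - pure (A v) (B (k w)).
Proof.
move=> Ak Bk.
rewrite half_parityE; push_linear; rewrite !tmapE !comp_lfunE.
rewrite !half_parityE !Ak !Bk; push_linear; rewrite !kk.
by tensor_coordinates; field.
Qed.

Lemma half_parity_even (A B : 'End(V)) v w :
  (forall v, A (k v) = k (A v)) -> (forall v, B (k v) = k (B v)) ->
  half_parity (tmap A B (half_parity (pure v w))) = pure (A v) (B w).
Proof.
move=> Ak Bk; rewrite half_parityE; push_linear; rewrite !tmapE.
by rewrite !half_parityE !Ak !Bk !kk; tensor_coordinates; field.
Qed.

Lemma half_parity_gauss p q r s z v w :
  half_parity (gauss p q r s z (half_parity (pure v w))) =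
  pure v w - 2 *: (- (p *: pure (y v) (x (k w))) - q *: pure (x v) (y (k w))
             - r *: pure (y v) (y (k w)) - s *: pure (x v) (x (k w)))
     + z *: pure (x (y v)) (x (y w)).
Proof.
have xyk u : (x \o y)%VF (k u) = k ((x \o y)%VF u).
  by rewrite !comp_lfunE; normalize.
have S1 : half_parity (half_parity (pure v w)) = pure v w.
  by rewrite -comp_lfunE half_parityK id_lfunE.
rewrite gauss_apply.
have So := half_parity_odd v w; have Se := half_parity_even v w.
move: So Se S1; move: half_parity => S So Se S1.
by push_linear; rewrite S1 !So // Se // !comp_lfunE !scalerN.
Qed.

(** Conjugation by the signed flip exchanges the slots, hence p and q; moving [k] back across an odd
    operator gives the minus signs. *)
Lemma gauss_flip p q r s z :
  (flip V V \o half_parity \o gauss p q r s z \o flip V V \o half_parity)%VF =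
  gauss (- q) (- p) (- r) (- s) z.
Proof.
have Sf t : half_parity (flip V V t) = flip V V (half_parity t).
  by rewrite -!comp_lfunE half_parity_flip.
apply: tens_ext => v w; rewrite !comp_lfunE -(Sf (pure v w)) flipE.
rewrite half_parity_gauss gaussE; push_linear; rewrite !flipE; normalize.
by tensor_coordinates; ring.
Qed.

Lemma gauss0 : gauss 0 0 0 0 0 = \1%VF.
Proof. by rewrite /gauss !scale0r !addr0 scaler0 subr0. Qed.

Lemma tmap_id : tmap \1 \1 = \1%VF :> 'End(tens V V).
Proof. by apply: tens_ext => v w; rewrite tmapE !id_lfunE. Qed.

Lemma tmap_comp (A A' B B' : 'End(V)) :
  (tmap A B \o tmap A' B')%VF = tmap (A \o A')%VF (B \o B')%VF.
Proof. by apply: tens_ext => v w; rewrite !lfunOpE !tmapE !lfunOpE. Qed.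

Definition flip_trace (G : 'End(tens V V)) (v : V) : V :=
  \sum_i slice V (bcovec i \o k)%VF (flip V V (G (pure v (bvec i)))).

Lemma flip_traceD G G' v :
  flip_trace (G + G') v = flip_trace G v + flip_trace G' v.
Proof.
by rewrite -big_split; apply: eq_bigr => i _; rewrite add_lfunE !lfD.
Qed.

Lemma flip_traceZ c G v : flip_trace (c *: G) v = c *: flip_trace G v.
Proof.
by rewrite scaler_sumr; apply: eq_bigr => i _; rewrite scale_lfunE !lfZ.
Qed.

Lemma flip_traceN G v : flip_trace (- G) v = - flip_trace G v.
Proof. by rewrite -scaleN1r flip_traceZ scaleN1r. Qed.

Lemma flip_trace_tmap (A B : 'End(V)) v :
  flip_trace (tmap A B) v = B (k (A v)).
Proof.
rewrite [k (A v) in RHS]bvec_sum lf_sum; apply: eq_bigr => i _.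
by rewrite tmapE flipE sliceE comp_lfunE lfZ.
Qed.

Lemma flip_trace_half_parity (A B : 'End(V)) v :
  flip_trace (half_parity \o tmap A B)%VF v =
  2^-1 *: (B (k (A v)) + B (A v) + k (B (k (A v))) - k (B (A v))).
Proof.
rewrite /half_parity -tmap_id -comp_lfunZl !(comp_lfunDl, comp_lfunNl).
rewrite !tmap_comp flip_traceZ !flip_traceD flip_traceN !flip_trace_tmap.
by rewrite !lfunOpE !kk.
Qed.

(** Tracing a flipped A (x) B multiplies the two operators around [k], so the r and s terms contain
    y y or x x and the z term contains x y x y; all of these vanish. *)
Lemma flip_trace_gauss p q r s z v :
  flip_trace (half_parity \o gauss p q r s z)%VF v = v + (2 * (p - q)) *: x (y
    v).
Proof.
rewrite /gauss -tmap_id !(comp_lfunDr, comp_lfunNr) -!comp_lfunZr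
  !(comp_lfunDr) -!comp_lfunZr.
rewrite !(flip_traceD, flip_traceN, flip_traceZ) !flip_trace_half_parity.
rewrite !lfunOpE; normalize.
move: (x (y v)) (k (x (y v))) (k v) => u u' u''.
by coordinates; field.
Qed.

Section Deformation.
Variables am ap bm bp : C.
Let D := 1 + (am * bp - ap * bm).

Definition self_braid : 'End(tens V V) :=
  (flip V V \o (half_parity \o ((\1 - 2 *: tmap (y \o k) x)
    \o (\1 - 2 *: tmap ((am *: y + bm *: x) \o k) (ap *: y + bp *: x)))))%VF.

(** The last coefficient is 4pq for p = tD and q = -tD, so this is a true exponential and depends
    additively on t. *)
Definition self_monodromy (t : C) : 'End(tens V V) :=
  gauss (t * D) (- (t * D)) 0 0 (- 4 * (t * D) ^+ 2).

Lemma self_braid_factor1 :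
  (\1 - 2 *: tmap (y \o k) x)%VF = gauss 1 0 0 0 0.
Proof.
apply: tens_ext => v w; rewrite gaussE add_lfunE opp_lfunE scale_lfunE.
by rewrite id_lfunE tmapE comp_lfunE; tensor_coordinates; ring.
Qed.

Lemma self_braid_factor2 :
  (\1 - 2 *: tmap ((am *: y + bm *: x) \o k) (ap *: y + bp *: x))%VF =
  gauss (am * bp) (ap * bm) (am * ap) (bm * bp) 0.
Proof.
apply: tens_ext => v w; rewrite gaussE add_lfunE opp_lfunE scale_lfunE.
rewrite id_lfunE tmapE comp_lfunE !add_lfunE !scale_lfunE.
rewrite ?pureDl ?pureDr ?pureZl ?pureZr.
by tensor_coordinates; ring.
Qed.

Lemma self_braidE : self_braid =
  (flip V V \o (half_parity \o gauss (1 + am * bp) (ap * bm) (am * ap)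
    (bm * bp) (4 * (ap * bm))))%VF.
Proof.
congr comp_lfun; congr comp_lfun.
transitivity (gauss 1 0 0 0 0 \o gauss (am * bp) (ap * bm) (am * ap) (bm * bp)
  0)%VF.
  by congr comp_lfun; [apply: self_braid_factor1|apply: self_braid_factor2].
by rewrite gauss_comp; apply: eq_gauss; ring.
Qed.

Lemma self_monodromyD t u :
  (self_monodromy t \o self_monodromy u)%VF = self_monodromy (t + u).
Proof. by rewrite gauss_comp; apply: eq_gauss; ring. Qed.

Lemma self_monodromy0 : self_monodromy 0 = \1%VF.
Proof. by rewrite -gauss0; apply: eq_gauss; ring. Qed.

Lemma self_braid_sqr : (self_braid \o self_braid)%VF = self_monodromy 1.
Proof.
rewrite self_braidE -!comp_lfunA (comp_lfunA half_parity) (comp_lfunA (flip V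
  V)).
rewrite !comp_lfunA gauss_flip gauss_comp; apply: eq_gauss; rewrite /D; ring.
Qed.

Lemma flip_trace_self_braid t v :
  \sum_i slice V (bcovec i \o k)%VF
    ((self_braid \o self_monodromy t)%VF (pure v (bvec i))) =
  v + (2 * (2 * t + 1) * D) *: x (y v).
Proof.
rewrite self_braidE -!comp_lfunA gauss_comp.
under eq_bigr do rewrite comp_lfunE.
rewrite -/(flip_trace _ _) flip_trace_gauss; congr (_ + _ *: _).
by rewrite /D; ring.
Qed.

Lemma self_braidV_left : (self_monodromy (-1) \o self_braid \o self_braid)%VF =
  \1%VF.
Proof.
by rewrite -comp_lfunA self_braid_sqr self_monodromyD addNr self_monodromy0.
Qed.

Lemma self_braidV : (self_braid^-1)%VF = (self_braid \o self_monodromy (-1))%VF.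
Proof.
apply: lfun_left_inv; rewrite -comp_lfunA.
(* The left inverse W(-1) c of c, with W the monodromy group, is also a right inverse; reassociated,
   this says that c W(-1) is a left inverse. *)
have <- := lfun_left_inv_comp self_braidV_left.
congr comp_lfun.
Qed.

End Deformation.
End SelfBraiding.

(** A family additive over all integers handles both branches of [gpow] at once. *)
Lemma RT_gpow (F : fieldType) (H : rqHopf F) (u : word H)
    (T T' : Defs.rgraph u u) (W : int -> 'End(wmod u)) :
  W 0 = \1%VF -> (forall m n, (W m \o W n)%VF = W (m + n)) ->
  RT T = W 1 -> RT T' = (RT T)^-1%VF -> forall n, RT (gpow T T' n) = W n.
Proof.
move=> W0 WD T1 T2.
have {}T2 : RT T' = W (-1).
  by rewrite T2 T1; apply: lfun_left_inv; rewrite WD addNr.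
case=> n /=.
  elim: n => [|n IH] /=; first by rewrite W0.
  by rewrite IH T1 WD intS.
elim: n => [|n IH] /=; first by rewrite T2 comp_lfun1r.
by rewrite {}IH T2 WD !NegzE [in RHS]intS opprD.
Qed.

Lemma big_ord2 (T : Type) (idx : T) (op : T -> T -> T) (G : 'I_2 -> T) :
  \big[op/idx]_(j < 2) G j = op (G ord0) (op (G ord_max) idx).
Proof.
rewrite 2!big_ord_recl big_ord0.
by congr (op _ (op (G _) _)); apply: val_inj.
Qed.

(** * Computations in the symplectic fermion algebra *)

Section Relations.
Variables (C : numClosedFieldType) (H : falgType C) (K : H).
Variable f : 'I_2 -> bool -> H.
Hypothesis rel : sf_relations K f.
Local Notation e0 := (e0 K).
Local Notation e1 := (e1 K).

Lemma two_neq0 : 2 != 0 :> C. Proof. by rewrite pnatr_eq0. Qed.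

Lemma rel_fKN i s : f i s * K = - (K * f i s).
Proof. by apply/eqP; rewrite -addr_eq0; apply/eqP/(rel_fK rel). Qed.

Lemma rel_ffN i j s : f i s * f j s = - (f j s * f i s).
Proof. by apply/eqP; rewrite -addr_eq0; apply/eqP/(rel_ff rel). Qed.

Lemma rel_ff0 i s : f i s * f i s = 0.
Proof.
have := rel_ff rel i i s; rewrite -mulr2n -scaler_nat => /eqP.
by rewrite scaler_eq0 (negbTE two_neq0) => /eqP.
Qed.

Lemma rel_mp i j :
  f i false * f j true = (i == j)%:R *: e1 - f j true * f i false.
Proof. by rewrite eq_sym -(rel_fpfm rel) addrAC subrr add0r. Qed.

Lemma rel_pm_neq i j s t : i != j -> f i s * f j t = - (f j t * f i s).
Proof.
move=> ij; case: (altP (s =P t)) => [->|st]; first exact: rel_ffN.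
have -> : s = ~~ t by case: s t st => [] [].
apply/eqP; rewrite -addr_eq0; apply/eqP.
have [] := (rel_fpfm rel i j, rel_fpfm rel j i).
rewrite (eq_sym j) (negbTE ij) !scale0r => E1 E2.
by case: t {st} => /=; [rewrite addrC|].
Qed.

Lemma KK_f i s : f i s * K ^+ 2 = K ^+ 2 * f i s.
Proof. by rewrite expr2 mulrA rel_fKN mulNr -(mulrA K (f i s)) rel_fKN mulrN
  opprK mulrA. Qed.

Lemma f_e1 i s : f i s * e1 = e1 * f i s.
Proof.
by rewrite /Defs.e1 -scalerAr -scalerAl mulrBr mulrBl KK_f mulr1 mul1r.
Qed.

Lemma f_e0 i s : f i s * e0 = e0 * f i s.
Proof.
by rewrite /Defs.e0 -scalerAr -scalerAl mulrDr mulrDl KK_f mulr1 mul1r.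
Qed.

Lemma K_e1 : K * e1 = e1 * K.
Proof.
by rewrite /Defs.e1 -scalerAr -scalerAl mulrBr mulrBl mulr1 mul1r -exprS exprSr.
Qed.

Lemma K_e0 : K * e0 = e0 * K.
Proof.
by rewrite /Defs.e0 -scalerAr -scalerAl mulrDr mulrDl mulr1 mul1r -exprS exprSr.
Qed.

Lemma e0_add_e1 : e0 + e1 = 1.
Proof.
rewrite /Defs.e0 /Defs.e1 -scalerDr addrACA subrr addr0 -mulr2n -scaler_nat.
by rewrite scalerA mulVf ?scale1r // two_neq0.
Qed.

Lemma KK_e1 : K ^+ 2 * e1 = - e1.
Proof.
rewrite /Defs.e1 -scalerAr mulrBr mulr1 -exprD (rel_K4 rel).
by rewrite -scalerN opprB.
Qed.

Lemma KK_e0 : K ^+ 2 * e0 = e0.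
Proof.
rewrite /Defs.e0 -scalerAr mulrDr mulr1 -exprD (rel_K4 rel).
by rewrite addrC.
Qed.

Lemma KK_eB : K ^+ 2 = e0 - e1.
Proof. by rewrite -[LHS]mulr1 -e0_add_e1 mulrDr KK_e0 KK_e1. Qed.

Lemma e1_e1 : e1 * e1 = e1.
Proof.
rewrite {1}/Defs.e1 -scalerAl mulrBl mul1r KK_e1 opprK -mulr2n -scaler_nat.
by rewrite scalerA mulVf ?scale1r // two_neq0.
Qed.

Lemma e0_e1 : e0 * e1 = 0.
Proof. by rewrite -[e0](addrK e1) e0_add_e1 mulrBl mul1r e1_e1 subrr. Qed.

Lemma e1_e0 : e1 * e0 = 0.
Proof. by rewrite -[e0](addrK e1) e0_add_e1 mulrBr mulr1 e1_e1 subrr. Qed.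

Lemma e0_e0 : e0 * e0 = e0.
Proof. by rewrite -{1}[e0](addrK e1) e0_add_e1 mulrBl mul1r e1_e0 subr0. Qed.

Definition pair_number i : H := f i true * f i false.
Local Notation w := pair_number.

Lemma ww i : w i * w i = e1 * w i.
Proof.
have -> : w i * w i = f i true * (f i false * f i true) * f i false.
  by rewrite /pair_number !mulrA.
by rewrite rel_mp eqxx scale1r mulrBr mulrBl f_e1 !mulrA rel_ff0 !mul0r subr0.
Qed.

Lemma K_w i : K * w i = w i * K.
Proof.
have -> : w i * K = f i true * (f i false * K) by rewrite /pair_number !mulrA.
by rewrite rel_fKN mulrN (mulrA (f i true)) rel_fKN mulNr opprK /pair_number
  mulrA.
Qed.

Lemma par_factor_comm i u :
  w i * u = u * w i -> (1 - 2 *: w i) * u = u * (1 - 2 *: w i).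
Proof. by move=> wu; rewrite mulrBl mul1r mulrBr mulr1 -scalerAl -scalerAr wu.
  Qed.

Lemma KK_mul u : K ^+ 2 * u = u - 2 *: (e1 * u).
Proof.
rewrite KK_eB mulrBl -[e0](addrK e1) e0_add_e1 !mulrBl mul1r.
by move: u (e1 * u) => v v'; coordinates; ring.
Qed.

(** Where e_0 = 1, w has square zero and the inverse is 1 + 2w. Where e_1 = 1, w is idempotent and 1
    - 2w is an involution. The factor K^2 = e_0 - e_1 treats both cases together. *)
Lemma par_factor_inv i : (1 - 2 *: w i) * (1 + 2 *: (K ^+ 2 * w i)) = 1.
Proof.
have wK : w i * K ^+ 2 = K ^+ 2 * w i.
  by rewrite expr2 mulrA -K_w -mulrA -K_w mulrA.
have E : w i * (K ^+ 2 * w i) = - (e1 * w i).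
  by rewrite mulrA wK -mulrA ww mulrA KK_e1 mulNr.
rewrite mulrBl mul1r mulrDr mulr1 -scalerAl -scalerAr E KK_mul.
by move: 1 (w i) (e1 * w i) => u v t; coordinates; ring.
Qed.

Lemma par_factor_unit i : (1 - 2 *: w i) \is a GRing.unit.
Proof.
have wKw : w i * (K ^+ 2 * w i) = K ^+ 2 * w i * w i.
  by rewrite mulrA expr2 mulrA -K_w -(mulrA K) -K_w mulrA.
have wE : w i * (1 + 2 *: (K ^+ 2 * w i)) = (1 + 2 *: (K ^+ 2 * w i)) * w i.
  by rewrite mulrDr mulrDl mulr1 mul1r -scalerAl -scalerAr wKw.
apply/unitrP; exists (1 + 2 *: (K ^+ 2 * w i)).
by split; rewrite -1?(par_factor_comm wE) par_factor_inv.
Qed.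

Lemma fermion_parityE :
  fermion_parity f = (1 - 2 *: w ord0) * (1 - 2 *: w ord_max).
Proof. by rewrite /fermion_parity big_ord2 mulr1. Qed.

Lemma w_f i s : w i * f i s = (if s then e1 * f i s else 0).
Proof.
rewrite /pair_number -mulrA; case: s; last by rewrite rel_ff0 mulr0.
by rewrite rel_mp eqxx scale1r mulrBr f_e1 mulrA rel_ff0 mul0r subr0.
Qed.

Lemma f_w i s : f i s * w i = (if s then 0 else e1 * f i s).
Proof.
rewrite /pair_number mulrA; case: s; first by rewrite rel_ff0 mul0r.
by rewrite rel_mp eqxx scale1r mulrBl -mulrA rel_ff0 mulr0 subr0.
Qed.

Lemma w_f_neq i j s : i != j -> w i * f j s = f j s * w i.
Proof.
move=> ij; have -> : w i * f j s = f i true * (f i false * f j s) by rewrite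
  /pair_number mulrA.
rewrite (rel_pm_neq _ _ ij) mulrN (mulrA (f i true)) (rel_pm_neq _ _ ij).
by rewrite mulNr opprK /pair_number mulrA.
Qed.

Lemma par_factor_f i s : (1 - 2 *: w i) * f i s = K ^+ 2 * (f i s * (1 - 2 *: w
  i)).
Proof.
rewrite mulrBl mul1r mulrBr mulr1 -scalerAl -scalerAr w_f f_w KK_mul.
have e1f : e1 * (e1 * f i s) = e1 * f i s by rewrite mulrA e1_e1.
case: s e1f => e1f; rewrite ?scaler0 ?subr0 // mulrBr -scalerAr e1f.
by move: (f i false) (e1 * f i false) => u v; coordinates; ring.
Qed.

Lemma parity_f i s :
  fermion_parity f * f i s = K ^+ 2 * (f i s * fermion_parity f).
Proof.
have q j t : j != i -> (1 - 2 *: w j) * f i t = f i t * (1 - 2 *: w j).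
  by move=> ji; apply/par_factor_comm/w_f_neq.
have wK j : (1 - 2 *: w j) * K ^+ 2 = K ^+ 2 * (1 - 2 *: w j).
  by apply: par_factor_comm; rewrite expr2 mulrA -K_w -mulrA -K_w mulrA.
rewrite fermion_parityE; have [i0|i0] := eqVneq i ord0.
  rewrite -i0 -mulrA (q ord_max) ?i0 // -i0 mulrA par_factor_f.
  by rewrite -!mulrA.
have <- : i = ord_max by case: i i0 {q} => [[|[]]] // ? ?; apply: val_inj.
rewrite -mulrA par_factor_f mulrA wK -mulrA; congr (_ * _).
by rewrite !mulrA (q ord0) // eq_sym.
Qed.

Lemma K_parity : K * fermion_parity f = fermion_parity f * K.
Proof.
have qK j : (1 - 2 *: w j) * K = K * (1 - 2 *: w j).
  by apply: par_factor_comm; rewrite K_w.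
by rewrite fermion_parityE -mulrA qK mulrA qK mulrA.
Qed.

Lemma w_e1 i : w i * e1 = e1 * w i.
Proof.
have -> : w i * e1 = f i true * (f i false * e1) by rewrite /pair_number mulrA.
by rewrite f_e1 (mulrA (f i true)) f_e1 /pair_number mulrA.
Qed.

Lemma parity_e1 : fermion_parity f * e1 = e1 * fermion_parity f.
Proof.
have qe j : (1 - 2 *: w j) * e1 = e1 * (1 - 2 *: w j).
  exact/par_factor_comm/w_e1.
by rewrite fermion_parityE -mulrA qe mulrA qe mulrA.
Qed.

Lemma parity_sqr : e1 * (fermion_parity f * fermion_parity f) = e1.
Proof.
have qe j : e1 * ((1 - 2 *: w j) * (1 - 2 *: w j)) = e1.
  (* The correction term lies in the e_0 part, so multiplication by e_1 kills it. *)
  have -> : (1 - 2 *: w j) * (1 - 2 *: w j) = 1 - 4 *: (w j - e1 * w j).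
    rewrite mulrBl mul1r mulrBr mulr1 -scalerAl -scalerAr ww.
    by move: 1 (w j) (e1 * w j) => u v t; coordinates; ring.
  rewrite mulrBr mulr1 -(scalerAr 4) mulrBr (mulrA e1 e1) e1_e1 subrr scaler0.
  exact: subr0.
have qq : (1 - 2 *: w ord_max) * (1 - 2 *: w ord0) =
          (1 - 2 *: w ord0) * (1 - 2 *: w ord_max).
  have ww' : w ord_max * w ord0 = w ord0 * w ord_max.
    rewrite [w ord0]/pair_number mulrA w_f_neq // -mulrA w_f_neq //.
    exact: mulrA.
  rewrite !mulrBl !mulrBr !mul1r !mulr1 -!scalerAl -!scalerAr ww'.
  by move: 1 (w ord0) (w ord_max) (w ord0 * w ord_max) => u v u' v';
    coordinates; ring.
rewrite fermion_parityE.
move: (1 - 2 *: w ord0) (1 - 2 *: w ord_max) (qe ord0) (qe ord_max) qq.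
move=> a b aa bb ba; have -> : a * b * (a * b) = a * a * (b * b).
  by rewrite -!mulrA (mulrA b a) ba -(mulrA a b).
by rewrite (mulrA e1 (a * a)) aa bb.
Qed.

(** * The ribbon element: invertibility, centrality, eigenvalues *)

Section Ribbon.
Variable beta : C.
Hypothesis beta0 : beta != 0.

Lemma ribbon_head_unit :
  e0 - (beta * 'i) *: (K * e1) \is a GRing.unit.
Proof.
have KeKe : (K * e1) * (K * e1) = - e1.
  by rewrite -mulrA (mulrA e1) -K_e1 -(mulrA K) e1_e1 mulrA -expr2 KK_e1.
have Kee : (K * e1) * e0 = 0 by rewrite -mulrA e1_e0 mulr0.
have eKe : e0 * (K * e1) = 0 by rewrite mulrA -K_e0 -mulrA e0_e1 mulr0.
have mulE (u t : H) a b : u * t = 0 -> t * u = 0 ->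
    (u - a *: t) * (u - b *: t) = u * u + (a * b) *: (t * t).
  move=> ut tu; rewrite mulrBl !mulrBr -!scalerAl -!scalerAr ut tu.
  by rewrite !scaler0 subr0 sub0r opprK scalerA.
have E a b : (e0 - a *: (K * e1)) * (e0 - b *: (K * e1)) = e0 - (a * b) *: e1.
  by rewrite mulE // e0_e0 KeKe scalerN.
(* Since (K e_1)^2 = -e_1, the product with coefficients a, b is e_0 - ab e_1, which is 1 exactly
   when ab = -1. *)
apply/unitrP; exists (e0 - (beta^-1 * 'i) *: (K * e1)).
have ii : 'i * 'i = -1 :> C by rewrite -expr2 sqrCi.
have ab : beta * 'i * (beta^-1 * 'i) = -1 by rewrite mulrACA ii mulfV // mul1r.
by rewrite !E (mulrC (beta^-1 * 'i)) ab scaleN1r opprK e0_add_e1.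
Qed.

Lemma ribbon_unit : sf_ribbon K f beta \is a GRing.unit.
Proof.
rewrite /sf_ribbon fermion_parityE.
rewrite unitrMl ?ribbon_head_unit // unitrMl; apply: par_factor_unit.
Qed.

Lemma mul_subZl (u t c : H) a : (u - a *: t) * c = u * c - a *: (t * c).
Proof. by rewrite mulrBl -scalerAl. Qed.

Lemma mul_subZr (u t c : H) a : c * (u - a *: t) = c * u - a *: (c * t).
Proof. by rewrite mulrBr -scalerAr. Qed.

Lemma ribbon_K : sf_ribbon K f beta * K = K * sf_ribbon K f beta.
Proof.
rewrite /sf_ribbon -mulrA -K_parity (mulrA _ K) (mulrA K); congr (_ * _).
by rewrite mul_subZl mul_subZr K_e0 -(mulrA K) K_e1.
Qed.

Lemma ribbon_f i s : sf_ribbon K f beta * f i s = f i s * sf_ribbon K f beta.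
Proof.
rewrite /sf_ribbon -mulrA parity_f (mulrA _ (K ^+ 2)) (mulrA _ (f i s)).
rewrite (mulrA (f i s)); congr (_ * _).
rewrite -mulrA mul_subZl mul_subZr f_e0.
have -> : e0 * (K ^+ 2 * f i s) = e0 * f i s.
  by rewrite mulrA KK_eB mulrBr e0_e0 e0_e1 subr0.
congr (_ - _ *: _).
have e1KK : e1 * (K ^+ 2 * f i s) = - (e1 * f i s).
  by rewrite mulrA KK_eB mulrBr e1_e0 e1_e1 sub0r mulNr.
by rewrite -mulrA e1KK mulrN mulrA rel_fKN mulNr -mulrA f_e1.
Qed.

(** On the e_1 part the ribbon element is -beta times the involution i K Q, with Q the fermion
    parity, and [e1pm] is the spectral projection of this involution for the eigenvalue -s. *)
Lemma ribbon_e1pm s :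
  sf_ribbon K f beta * e1pm K f s = (beta * sgn C s) *: e1pm K f s.
Proof.
rewrite /sf_ribbon /e1pm.
set Q := fermion_parity f; set z := _ - _.
have ze t : z * (e1 * t) = - (beta * 'i) *: (K * (e1 * t)).
  by rewrite mul_subZl mulrA e0_e1 mul0r sub0r -mulrA (mulrA e1) e1_e1 scaleNr.
have QQ : e1 * (Q * Q) = e1 by apply: parity_sqr.
have Qe t : Q * (e1 * t) = e1 * (Q * t) by rewrite mulrA parity_e1 -mulrA.
have KKe : K * (e1 * K) = - e1.
  by rewrite -K_e1 mulrA -expr2 KK_e1.
have ss : sgn C s * sgn C s = 1 by case: s => /=; rewrite ?mulrNN mul1r.
have ii : 'i * 'i = -1 :> C by rewrite -expr2 sqrCi.
rewrite -scalerAr [RHS]scalerA [_ * 2^-1]mulrC -[RHS]scalerA; congr (_ *: _).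
rewrite -mulrA Qe mul_subZr mulr1 ze.
have -> : Q * (K * Q) = K * (Q * Q) by rewrite mulrA -K_parity -mulrA.
have -> : K * (e1 * (Q - (sgn C s * 'i) *: (K * (Q * Q)))) =
    e1 * (K * Q) + (sgn C s * 'i) *: e1.
  rewrite (mulrA K e1) K_e1 -(mulrA e1 K) mul_subZr (mulrA K K) -expr2.
  rewrite (mulrA (K ^+ 2)) mul_subZr; congr (_ + _).
  have -> : e1 * (K ^+ 2 * Q * Q) = - e1.
    rewrite -(mulrA _ Q) (mulrA e1 (K ^+ 2)) KK_eB mulrBr e1_e0 e1_e1 sub0r
      mulNr QQ //.
  by rewrite scalerN opprK.
rewrite [in RHS]mul_subZr mulr1 scalerDr scalerBr !scalerA.
have -> : - (beta * 'i) * (sgn C s * 'i) = beta * sgn C s.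
  by rewrite mulNr mulrACA ii mulrN1 opprK.
have -> : beta * sgn C s * (sgn C s * 'i) = beta * 'i.
  by rewrite -mulrA (mulrA (sgn C s)) ss mul1r.
by rewrite scaleNr addrC.
Qed.
End Ribbon.
End Relations.

(* Conjugation by u fixes the generators, hence is the identity by the        *)
(* uniqueness part of the presentation.                                       *)
Lemma presented_central (C : numClosedFieldType) (H : falgType C) (K : H)
    (f : 'I_2 -> bool -> H) (u : H) :
  sf_presented K f -> u \is a GRing.unit -> u * K = K * u ->
  (forall i s, u * f i s = f i s * u) -> forall a, u * a = a * u.
Proof.
move=> [rel univ] Uu uK uf a.
have conjE (b : H) : u * b = b * u -> u * b * u^-1 = b.
  by move=> ->; rewrite mulrK.
pose conj (b : H) := u * b * u^-1.
have conj_lin : linear conj.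
  by move=> c b b'; rewrite /conj mulrDr mulrDl -scalerAr -scalerAl.
have conj_mon : monoid_morphism conj.
  split=> [|b b']; first by rewrite /conj mulr1 divrr.
  by rewrite /conj !mulrA divrK.
pose psi : {lrmorphism H -> H} := HB.pack conj
  (GRing.isLinear.Build C H H _ conj conj_lin)
  (GRing.isMonoidMorphism.Build H H conj conj_mon).
have [phi [_ phi_uniq]] := univ H K f rel.
have E1 := phi_uniq psi (conjE _ uK) (fun i s => conjE _ (uf i s)) a.
have E2 := phi_uniq idfun erefl (fun i s => erefl) a.
have : conj a = a by rewrite -[conj a]/(psi a) E1 -E2.
by rewrite /conj => {2}<-; rewrite divrK.
Qed.

Section Actions.
Variables (C : numClosedFieldType) (H : rqHopf C) (K : H).
Variables (f : 'I_2 -> bool -> H) (beta : C).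
Hypothesis rel : sf_relations K f.
Variable M : amod H.

Lemma act_fK i s v : act M (f i s) (act M K v) = - act M K (act M (f i s) v).
Proof. by rewrite -!actMv (rel_fKN rel) actNv. Qed.

Lemma act_ff0 i s v : act M (f i s) (act M (f i s) v) = 0.
Proof. by rewrite -!actMv (rel_ff0 rel) act0v. Qed.

Lemma act_mp i j v : act M (f i false) (act M (f j true) v) =
  (i == j)%:R *: act M (e1 K) v - act M (f j true) (act M (f i false) v).
Proof. by rewrite -!actMv (rel_mp rel) actDv actNv actZv. Qed.

Lemma act_e1 v : act M (e1 K) v = 2^-1 *: (v - act M K (act M K v)).
Proof. by rewrite /e1 expr2 !actE. Qed.

Lemma act_e0 v : act M (e0 K) v = 2^-1 *: (v + act M K (act M K v)).
Proof. by rewrite /e0 expr2 !actE. Qed.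

End Actions.

(** * The action on P_mu *)

Section Deformed.
Variables (C : numClosedFieldType) (H : rqHopf C) (K : H).
Variables (f : 'I_2 -> bool -> H) (beta : C).
Hypothesis rel : sf_relations K f.
Variables (mu : 'M[C]_2) (P : amod H).
Local Notation k := (act P K).
Local Notation x := (act P (f ord0 true)).
Local Notation y := (act P (f ord0 false)).
Local Notation am := (mu ord0 ord0).
Local Notation ap := (mu ord0 ord_max).
Local Notation bm := (mu ord_max ord0).
Local Notation bp := (mu ord_max ord_max).
Local Notation D := (1 + (am * bp - ap * bm)).

Variable v0 : P.
Hypothesis basisP : basis_of {:P} [:: v0; x v0; y v0; x (y v0)].
Hypothesis kv0 : k v0 = v0.
Hypothesis f2E : forall s : bool, act P (f ord_max s) =
  mu ord0 (if s then ord_max else ord0) *: y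
  + mu ord_max (if s then ord_max else ord0) *: x.

Lemma P_ext (Z : vectType C) (g h : 'Hom(P, Z)) :
  g v0 = h v0 -> g (x v0) = h (x v0) -> g (y v0) = h (y v0) ->
  g (x (y v0)) = h (x (y v0)) -> g = h.
Proof.
move=> g1 g2 g3 g4; apply/lfunP => v.
have : v \in <<[:: v0; x v0; y v0; x (y v0)]>>%VS.
  by rewrite (span_basis basisP) memvf.
suff /subvP s : (<<[:: v0; x v0; y v0; x (y v0)]>> <= lker (g - h))%VS.
  by move/s; rewrite memv_ker add_lfunE opp_lfunE subr_eq0 => /eqP.
apply/span_subvP => u; rewrite !inE memv_ker add_lfunE opp_lfunE subr_eq0.
by case/or4P => /eqP ->; apply/eqP.
Qed.

Lemma P_KK v : k (k v) = v.
Proof.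
have kkf i s u : k (k (act P (f i s) u)) = act P (f i s) (k (k u)).
  by rewrite !(act_fK rel) lfN opprK.
have : (k \o k)%VF = \1%VF.
  by apply: P_ext; rewrite comp_lfunE id_lfunE ?kkf !kv0.
by move/lfunP/(_ v); rewrite comp_lfunE id_lfunE.
Qed.

Lemma P_e1 v : act P (e1 K) v = 0.
Proof. by rewrite act_e1 P_KK subrr scaler0. Qed.

Lemma P_e0 v : act P (e0 K) v = v.
Proof.
rewrite act_e0 P_KK -mulr2n -scaler_nat scalerA mulVf ?scale1r //.
exact: two_neq0.
Qed.

Lemma P_yx v : y (x v) = - x (y v).
Proof. by rewrite (act_mp rel) P_e1 scaler0 sub0r. Qed.

Lemma P_f i s : exists c d, forall v, act P (f i s) v = c *: x v + d *: y v.
Proof.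
have [->|i0] := eqVneq i ord0.
  case: s; [exists 1, 0|exists 0, 1] => v;
    by rewrite scale1r scale0r ?addr0 ?add0r.
have -> : i = ord_max by case: i i0 => [[|[]]] // ? ?; apply: val_inj.
eexists; eexists => v; rewrite f2E !lfunOpE addrC; reflexivity.
Qed.

Ltac normalize := repeat (progress
  rewrite ?lfD ?lfZ ?lfN ?P_yx ?(act_ff0 rel) ?lf0 ?opprK).

(** All four fermions act through the degree-one part of an exterior algebra on the two generators
    x, y. *)
Lemma P_f3 i j l s t u v : act P (f i s) (act P (f j t) (act P (f l u) v)) = 0.
Proof.
have [c1 [d1 E1]] := P_f i s; have [c2 [d2 E2]] := P_f j t.
have [c3 [d3 E3]] := P_f l u.
rewrite E3; push_linear; rewrite !E2; push_linear; rewrite !E1; normalize.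
by coordinates; ring.
Qed.

(** The determinant enters here: f_2^+ f_2^- acts as (det mu) x y, and products of two such terms
    vanish. *)
Lemma P_parity v : act P (fermion_parity f) v = v - (2 * D) *: x (y v).
Proof.
rewrite fermion_parityE /pair_number !actMv !actDv !actNv !actZv !act1v !actMv.
rewrite !f2E !add_lfunE !scale_lfunE; normalize.
by move: (x (y v)) => u; coordinates; ring.
Qed.

End Deformed.

(** * The associator and the R-matrix acting on modules *)

Section RAction.
Variables (C : numClosedFieldType) (H : rqHopf C) (K : H).
Variables (f : 'I_2 -> bool -> H) (beta : C).
Hypothesis Hsf : symplectic_fermions K f beta.
Implicit Types U V W : amod H.

Lemma tact3_pure U V W (a : tens H H) (c : H) :
  tact3 U V W (pure a c) = tmap (tact U V a) (act W c).
Proof.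
rewrite /tact3 tliftE // => [w|v] d s t; apply: tens_ext => u w'.
  by rewrite !lfunOpE !tmapE lfD lfZ !lfunOpE !pureE.
by rewrite !lfunOpE !tmapE lfD lfZ !lfunOpE !pureE.
Qed.

(** The nontrivial summand of Phi and of its inverse carries e_1 in its first slot. *)
Lemma tact3_sf_Phi U V W s : (forall v, act U (e1 K) v = 0) ->
  tact3 U V W (sf_Phi K beta s) = \1%VF.
Proof.
move=> e10; have e1U : act U (e1 K) = 0 by apply/lfunP => v; rewrite e10
  zero_lfunE.
rewrite /sf_Phi [LHS]linearD /= !tact3_pure tact1 act1 tactE e1U.
apply: tens_ext => t w; rewrite add_lfunE !tmapE !id_lfunE.
suff -> : tmap 0 (act V (e1 K)) = 0 :> 'End(tens U V).
  by rewrite zero_lfunE pure0l addr0.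
by apply: tens_ext => u v; rewrite tmapE !zero_lfunE pure0l.
Qed.

Lemma sf_Phi_trivial U : (forall v, act U (e1 K) v = 0) -> Phi_trivial U.
Proof.
by move=> e10 V W; rewrite (sf_PhiE Hsf) (sf_Phi_invE Hsf) !tact3_sf_Phi.
Qed.

(* Of the four summands of the R-matrix only the one with indices a, b        *)
(* survives on a tensor product of modules concentrated in degrees a and b.   *)
Definition concentrated U (a : 'I_2) :=
  forall n v, act U (e_ K n) v = (n == a)%:R *: v.

Lemma concentrated0 U : (forall v, act U K (act U K v) = v) -> concentrated U
  ord0.
Proof.
move=> KK n v; rewrite /e_; case: eqP => _.
  by rewrite act_e0 KK -mulr2n -scaler_nat scalerA mulVf ?two_neq0.
by rewrite act_e1 KK subrr scaler0 scale0r.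
Qed.

Lemma concentrated1 U :
  (forall v, act U K (act U K v) = - v) -> concentrated U ord_max.
Proof.
move=> KK n v; rewrite /e_; case: eqP => [->|n0].
  by rewrite act_e0 KK subrr scaler0 scale0r.
have -> : n = ord_max by case: n n0 => [[|[]]] // ? n0; [case: n0|]; apply:
  val_inj.
by rewrite act_e1 KK opprK -mulr2n -scaler_nat scalerA mulVf ?two_neq0.
Qed.

Definition parity_form U V (A : 'End(U)) (B : 'End(V)) : 'End(tens U V) :=
  2^-1 *: (\1 + tmap A \1 + tmap \1 B - tmap A B)%VF.

(** The powers of i split over the two slots and rescale each K; on modules concentrated in degrees
    a and b the rescaled operators are involutions, and rho is a Koszul sign. *)
Lemma tact_rho U V (a b : 'I_2) :
  tact U V (rho K a b) =
  parity_form ('i ^ (- a%:Z) *: act U K) ('i ^ b%:Z *: act V K).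
Proof.
rewrite /rho /parity_form linearZ /=; congr (_ *: _).
rewrite !(big_ord_recl, big_ord0) /= !addr0 !linearD !linearZ /=.
have -> : bump 0 0 = 1%N by [].
rewrite !tactE !mul0n !mul1n ?expr0 ?expr1 ?expr0z ?act1 ?sub0r.
rewrite expfzDr ?neq0Ci //; apply: tens_ext => u v.
rewrite !lfunOpE !tmapE !lfunOpE ?pureZl ?pureZr.
move: ('i ^ b%:Z) ('i ^ (- a%:Z)) => r s; tensor_coordinates; ring.
Qed.

Lemma tact_Rmat U V (a b : 'I_2) : concentrated U a -> concentrated V b ->
  tact U V (Rmat H) = ((beta ^+ (a * b) *: tact U V (rho K a b)) \o
    ((\1 - 2 *: tmap (act U (f ord0 false * omega K false)) (act V (f ord0
      true)))
     \o (\1 - 2 *: tmap (act U (f ord_max false * omega K false))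
                        (act V (f ord_max true)))))%VF.
Proof.
move=> cU cV; rewrite (sf_RE Hsf) /sf_R tactM; congr comp_lfun.
  have tE (n m : 'I_2) : tact U V (tmul (rho K n m) (pure (e_ K n) (e_ K m))) =
      ((n == a)%:R * (m == b)%:R) *: tact U V (rho K n m).
    rewrite tactM tactE; apply: tens_ext => u v.
    rewrite !lfunOpE tmapE cU cV pureZl pureZr scalerA lfZ //.
  rewrite linear_sum (bigD1 a) //= linear_sum (bigD1 b) //= linearZ /=.
  rewrite tE !eqxx mulr1 scale1r !big1 ?addr0 // => n na.
    rewrite linear_sum big1 // => m _; rewrite linearZ /= tE (negbTE na).
    by rewrite mul0r scale0r scaler0.
  by rewrite linearZ /= tE (negbTE na) mulr0 scale0r scaler0.
have E i : tact U V (pure 1 1 - 2 *: pure (f i false * omega K false) (f i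
  true)) =
    (\1 - 2 *: tmap (act U (f i false * omega K false)) (act V (f i true)))%VF.
  by rewrite linearB linearZ /= tact1 tactE.
by rewrite big_ord2 !tactM !E tact1 comp_lfun1r.
Qed.

End RAction.

(* A central element acts on X_1 as it does on e_1^s, because H e_1^s is a     *)
(* power of X_1.                                                              *)
Lemma X1_central (C : numClosedFieldType) (H : qHopf C) (K : H)
    (f : 'I_2 -> bool -> H) (s : bool) (X : amod H) (z : H) (c : C) w :
  is_X1 K f s X -> (forall a, z * a = a * z) ->
  z * e1pm K f s = c *: e1pm K f s -> act X z w = c *: w.
Proof.
case=> _ _ _ [g /amorphE g_mor [g' _ g'K]] zC ze.
pose cw : {ffun 'I_4 -> X} := [ffun=> w].
have zu (u : left_ideal_mod (e1pm K f s)) :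
    act (left_ideal_mod (e1pm K f s)) z u = c *: u.
  apply: subvs_inj; rewrite /= (lfun_linE (@left_ideal_act_linear _ _ _)).
  rewrite left_ideal_actE; have /memv_imgP[b _ ->] := subvsP u.
  rewrite !lfunE /= mulrA zC -mulrA ze -scalerAr.
  by [].
have := g_mor z (g' cw); rewrite zu g'K linearZ /= g'K.
move/(congr1 (fun h : {ffun 'I_4 -> X} => h ord0)).
by rewrite (lfun_linE (@pow_act_linear _ _ _ _)) pow_actE !ffunE.
Qed.

(** * Vanishing traces on modules with e_1 = 1 *)

Section OddTraces.
Variables (C : numClosedFieldType) (H : falgType C) (K : H).
Variable f : 'I_2 -> bool -> H.
Hypothesis rel : sf_relations K f.
Variable X : amod H.
Hypothesis Xe1 : forall v, act X (e1 K) v = v.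

Local Notation tau a := (trc (act X a)).

Lemma tau_mulC a b : tau (a * b) = tau (b * a).
Proof. by rewrite !actM trc_mulC. Qed.

Lemma tauN a : tau (- a) = - tau a.
Proof. by rewrite linearN trcN. Qed.

Lemma tau0 : tau 0 = 0.
Proof. by rewrite linear0 -(scale0r \1%VF) trcZ mul0r. Qed.

Lemma opp_eq0 (t : C) : t = - t -> t = 0.
Proof.
move/eqP; rewrite -addr_eq0 -mulr2n -mulr_natl mulf_eq0.
by rewrite (negbTE (two_neq0 C)) => /eqP.
Qed.

(* 1 = e_1 = {f_i^+, f_i^-} on X; a fermion pair that can be moved around the *)
(* trace with a sign then contributes 0.                                      *)
Lemma tau_insert i s a : tau a =
  tau (a * f i s * f i (~~ s)) + tau (a * f i (~~ s) * f i s).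
Proof.
rewrite -trcD -linearD /= -!mulrA -mulrDr.
have -> : f i s * f i (~~ s) + f i (~~ s) * f i s = e1 K.
  by have := rel_fpfm rel i i; rewrite eqxx scale1r => <-; case: s; rewrite //=
    addrC.
by congr trc; apply/lfunP => v; rewrite actMv Xe1.
Qed.

Lemma tau_pair i s a : a * f i s = - (f i s * a) ->
  tau (a * f i s * f i (~~ s)) + tau (a * f i (~~ s) * f i s) = 0.
Proof.
move=> af; rewrite [X in _ + X]tau_mulC mulrA -[f i s * a]opprK -af.
by rewrite mulNr tauN subrr.
Qed.

Lemma tau_K : tau K = 0.
Proof. by rewrite (tau_insert ord0 true) tau_pair // (rel_fKN rel) opprK. Qed.

Lemma tau_Kf i s : tau (K * f i s) = 0.
Proof. by apply: opp_eq0; rewrite {1}tau_mulC (rel_fKN rel) tauN. Qed.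

(** For i != j, inserting the pair of species i makes f_i^s meet itself in both terms. For i = j and
    s != t, the pair of the other species anticommutes with the whole word, so [tau_pair]
    applies. *)
Lemma tau_Kff i j s t : tau (K * f i s * f j t) = 0.
Proof.
have [->|ij] := eqVneq i j; last first.
  rewrite (tau_insert i s).
  have -> : K * f i s * f j t * f i s = 0.
    rewrite -mulrA (rel_pm_neq rel _ _ (_ : j != i)) 1?eq_sym // mulrN.
    by rewrite -(mulrA K) (mulrA (f i s)) (rel_ff0 rel) mul0r mulr0 oppr0.
  rewrite mul0r tau0 add0r tau_mulC 2!mulrA.
  have -> : f i s * (K * f i s) = 0.
    by rewrite mulrA (rel_fKN rel) mulNr -mulrA (rel_ff0 rel) mulr0 oppr0.
  by rewrite !mul0r tau0.
have [->|st] := eqVneq s t; first by rewrite -mulrA (rel_ff0 rel) mulr0 tau0.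
have [l lj] : exists l : 'I_2, l != j.
  by exists (if j == ord0 then ord_max else ord0); case: j => [[|[]]].
rewrite (tau_insert l true) tau_pair //.
have jl : j != l by rewrite eq_sym.
have -> : K * f j s * f j t * f l true = K * f l true * f j s * f j t.
  rewrite -(mulrA _ (f j t)) (rel_pm_neq rel _ _ jl) mulrN mulrA.
  by rewrite -(mulrA K (f j s)) (rel_pm_neq rel _ _ jl) mulrN mulNr opprK mulrA.
by rewrite !mulrA (rel_fKN rel) !mulNr opprK.
Qed.

End OddTraces.

(** * Evaluation of the cut diagrams on P_mu *)

Section Invariants.
Variables (C : numClosedFieldType) (H : rqHopf C) (K : H).
Variables (f : 'I_2 -> bool -> H) (beta : C).
Hypotheses (beta4 : beta ^+ 4 = 1) (Hsf : symplectic_fermions K f beta).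
Variables (mu : 'M[C]_2) (P : amod H).
Local Notation k := (act P K).
Local Notation x := (act P (f ord0 true)).
Local Notation y := (act P (f ord0 false)).
Local Notation am := (mu ord0 ord0).
Local Notation ap := (mu ord0 ord_max).
Local Notation bm := (mu ord_max ord0).
Local Notation bp := (mu ord_max ord_max).
Local Notation D := (1 + (am * bp - ap * bm)).

Variable v0 : P.
Hypothesis basisP : basis_of {:P} [:: v0; x v0; y v0; x (y v0)].
Hypothesis kv0 : k v0 = v0.
Hypothesis f2E : forall s : bool, act P (f ord_max s) =
  mu ord0 (if s then ord_max else ord0) *: y
  + mu ord_max (if s then ord_max else ord0) *: x.

Let rel : sf_relations K f := (sf_pres Hsf).1.
Let kk v : k (k v) = v. Proof. exact: (P_KK rel basisP kv0). Qed.
Let xk v : x (k v) = - k (x v). Proof. exact: (act_fK rel). Qed.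
Let yk v : y (k v) = - k (y v). Proof. exact: (act_fK rel). Qed.
Let xx v : x (x v) = 0. Proof. exact: (act_ff0 rel). Qed.
Let yy v : y (y v) = 0. Proof. exact: (act_ff0 rel). Qed.
Let yx v : y (x v) = - x (y v). Proof. exact: (P_yx rel basisP kv0). Qed.
Let Pe1 v : act P (e1 K) v = 0. Proof. exact: (P_e1 rel basisP kv0). Qed.
Let Pe0 v : act P (e0 K) v = v. Proof. exact: (P_e0 rel basisP kv0). Qed.

Lemma beta_neq0 : beta != 0.
Proof.
by apply/eqP => b0; move: beta4 => /eqP; rewrite b0 expr0n /= eq_sym oner_eq0.
Qed.

Lemma ribbonV M : forall v, act M (ribbon H)^-1 (act M (ribbon H) v) = v.
Proof.
move=> v; rewrite -actMv mulVr ?act1v // (sf_ribbonE Hsf).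
exact: (ribbon_unit rel beta_neq0).
Qed.

Definition unipotent (t : C) : 'End(P) := (\1 + t *: (x \o y))%VF.

Lemma unipotentE t v : unipotent t v = v + t *: x (y v).
Proof. by rewrite !lfunOpE. Qed.

Lemma unipotent0 : unipotent 0 = \1%VF.
Proof. by rewrite /unipotent scale0r addr0. Qed.

Lemma unipotentD s t : (unipotent s \o unipotent t)%VF = unipotent (s + t).
Proof.
apply/lfunP => v; rewrite comp_lfunE !unipotentE; push_linear.
rewrite yx lfN xx oppr0 scaler0 addr0.
by move: (x (y v)) => u; coordinates; ring.
Qed.

Lemma P_ribbon v : act P (ribbon H) v = unipotent (- (2 * D)) v.
Proof.
rewrite (sf_ribbonE Hsf) /sf_ribbon actMv (P_parity rel basisP kv0 f2E).
rewrite actDv actNv (actZv (beta * 'i)) actMv Pe0 Pe1 lf0 scaler0 subr0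
  unipotentE.
by rewrite scaleNr.
Qed.

Lemma twist_P : twist P = unipotent (2 * D).
Proof.
apply/lfunP => v; rewrite /twist -[v in LHS]id_lfunE -unipotent0.
rewrite -(addNr (2 * D)) -unipotentD comp_lfunE -P_ribbon; exact: ribbonV.
Qed.

Lemma RT_twist_P n :
  RT (gpow (gtwist (wpt P)) (gtwist_inv (wpt P)) n) = unipotent (2 * n%:~R * D).
Proof.
pose W (m : int) : 'End(P) := unipotent (2 * m%:~R * D).
have W0 : W 0 = \1%VF by rewrite /W mulr0 mul0r unipotent0.
have WD m l : (W m \o W l)%VF = W (m + l).
  by rewrite unipotentD /W intrD (mulrDr 2) (mulrDl _ _ D).
apply: (@RT_gpow _ H (wpt P) _ _ W W0 WD) => //=.
by rewrite twist_P /W mulr1.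
Qed.

Lemma P_pivot : act P (antip H (evel H) * pivot H) = k.
Proof.
apply/lfunP => v; rewrite (sf_evelE Hsf) antip1 mul1r (sf_pivotE Hsf).
by rewrite /sf_pivot actMv actDv Pe0 (actZv ((- 'i) ^+ 3)) actMv Pe1 scaler0
  addr0.
Qed.

Lemma P_coevel v : act P (coevel H) v = v.
Proof.
rewrite (sf_coevelE Hsf) /bbeta actDv Pe0 (actZv (beta ^+ 2)) actMv Pe1 lf0.
by rewrite scaler0 addr0.
Qed.

Lemma P_omega s : act P (omega K s) = k.
Proof.
by apply/lfunP => v; rewrite /omega actMv actDv Pe0 (actZv (_ * _)) Pe1 scaler0
  addr0.
Qed.

Lemma braiding_PP : braiding P P = self_braid k x y am ap bm bp.
Proof.
rewrite braiding_flip (tact_Rmat Hsf (concentrated0 kk) (concentrated0 kk)).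
rewrite tact_rho (actM P (f ord0 false)) (actM P (f ord_max false)) P_omega
  !f2E /= expr0 scale1r !expr0z !scale1r.
reflexivity.
Qed.

Lemma RT_iter (u : word H) (T : Defs.rgraph u u) n :
  RT (iter n (gcomp T) (gid u)) = lfun_iter (RT T) n.
Proof. by elim: n => //= n ->. Qed.

Lemma RT_torus (m : int) : odd `|m|%N ->
  RT (cut (torus m P)) = unipotent (2 * m%:~R * D).
Proof.
move=> om.
pose c := self_braid k x y am ap bm bp.
pose W := self_monodromy k x y am ap bm bp.
have [j mE RTm] : exists2 j : int, m = 2 * j + 1 &
    RT (gpow (gbraid (wpt P) (wpt P)) (gbraid_inv (wpt P) (wpt P)) m) =
    (c \o W j%:~R)%VF.
  have WD s t : (W s \o W t)%VF = W (s + t) by apply: self_monodromyD.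
  have cc : (c \o c)%VF = W 1 by apply: self_braid_sqr.
  have W0 : W 0 = \1%VF by apply: self_monodromy0.
  have iterE (d : 'End(tens P P)) (s : C) n : (d \o d)%VF = W s ->
      lfun_iter d n.*2 = W (n%:R * s).
    move=> dd; elim: n => [|n IH]; first by rewrite mul0r W0.
    rewrite doubleS /lfun_iter /= -/(lfun_iter d n.*2) IH comp_lfunA dd WD.
    by rewrite -add1n natrD mulrDl mul1r.
  case: m om => n /= on.
    exists n./2%:Z.
      by rewrite -{1}(odd_double_half n) on addrC -muln2 PoszD PoszM mulrC.
    rewrite RT_iter /= braiding_PP -/c -{1}(odd_double_half n) on add1n.
    by rewrite /lfun_iter /= -/(lfun_iter c _) (iterE _ _ _ cc) mulr1.
  have n2 : n = n./2.*2 by rewrite -{1}(odd_double_half n) (negbTE on).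
  (* Here m = -(n+1) with n even. The inverse braiding is d = c W(-1) with d^2 = W(-1), so d^(n+1) =
     c W(-1 - n/2). *)
  exists (- (n./2)%:Z - 1).
    rewrite NegzE -addn1 {1}n2 -muln2 PoszD PoszM; ring.
  rewrite RT_iter /= braiding_PP -/c self_braidV // -/c -/W.
  rewrite n2; move dE: (c \o W (-1))%VF => d.
  have dd : (d \o d)%VF = W (-1).
    have cd : (c \o d)%VF = \1%VF.
      by rewrite -dE comp_lfunA cc WD subrr W0.
    have: (W 1 \o (d \o d))%VF = \1%VF.
      by rewrite -cc -(comp_lfunA c c) (comp_lfunA c d d) cd comp_lfun1l.
    by move/(congr1 (comp_lfun (W (-1)))); rewrite comp_lfunA WD addNr W0
      comp_lfun1l comp_lfun1r.
  rewrite (iterE _ _ _ dd) -dE -comp_lfunA WD doubleK; congr (_ \o W _)%VF.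
  by rewrite intrB mulrN1 mulrNz addrC.
apply/lfunP => v.
rewrite RT_gclose_right; last exact: (sf_Phi_trivial Hsf).
rewrite P_pivot; under eq_bigr do rewrite P_coevel.
rewrite /= RTm flip_trace_self_braid // unipotentE mE; congr (_ + _ *: _).
by rewrite intrD intrM.
Qed.

Definition hopf_map (X : amod H) : 'End(tens P X) :=
  (braiding X P \o braiding P X)%VF.

Lemma parity_formE (U V : amod H) (A : 'End(U)) (B : 'End(V)) u v :
  parity_form A B (pure u v) =
  2^-1 *: (pure u v + pure (A u) v + pure u (B v) - pure (A u) (B v)).
Proof. by rewrite !lfunOpE !tmapE !id_lfunE. Qed.

Lemma slice_tmap (X : amod H) (A : 'End(P)) (B g h : 'End(X)) v :
  \sum_i slice P (bcovec i \o g)%VF (tmap A B (pure v (h (bvec i)))) =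
  trc (g \o B \o h)%VF *: A v.
Proof.
rewrite scaler_suml; apply: eq_bigr => i _.
by rewrite tmapE sliceE !comp_lfunE.
Qed.

Lemma RT_hopf (X : amod H) a b v :
  RT (cut (hopf_link P a X b)) v = \sum_i slice P
     (bcovec i \o act X (antip H (evel H) * pivot H))%VF
     (tmap (unipotent (2 * a%:~R * D)) (RT (gpow (gtwist (wpt X)) (gtwist_inv
       (wpt X)) b))
       (hopf_map X (pure v (act X (coevel H) (bvec i))))).
Proof.
rewrite RT_gclose_right; last exact: (sf_Phi_trivial Hsf).
by apply: eq_bigr => i _; rewrite /= -RT_twist_P !comp_lfunE.
Qed.

Lemma RT_hopf_X0 (s : bool) (X : amod H) a b : is_X0 K f s X ->
  RT (cut (hopf_link P a X b)) = sgn C s *: unipotent (2 * a%:~R * D).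
Proof.
case=> dimX KX fX.
have ss : sgn C s * sgn C s = 1 by case: s {KX} => /=; rewrite ?mulrNN mul1r.
have KKX v : act X K (act X K v) = v.
  by rewrite KX !scale_lfunE !id_lfunE scalerA ss scale1r.
have [Xe0 Xe1] : (forall v, act X (e0 K) v = v) /\ (forall v, act X (e1 K) v =
  0).
  split=> v; first by rewrite act_e0 KKX -mulr2n -scaler_nat scalerA mulVf
    ?scale1r ?two_neq0.
  by rewrite act_e1 KKX subrr scaler0.
have twX : twist X = \1%VF.
  apply/lfunP => v; rewrite id_lfunE -[RHS]ribbonV; congr (act X _ _).
  rewrite (sf_ribbonE Hsf) /sf_ribbon actMv fermion_parityE /pair_number.
  rewrite actMv !(actDv, actNv) !(actZv 2) !actMv !fX !zero_lfunE ?lf0 ?scaler0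
    ?subr0 !act1v.
  by rewrite (actZv (beta * 'i)) actMv Xe0 Xe1 lf0 scaler0 subr0.
have twXb : RT (gpow (gtwist (wpt X)) (gtwist_inv (wpt X)) b) = \1%VF.
  apply: (@RT_gpow _ H (wpt X) _ _ (fun=> \1%VF)) => //= m n.
  by rewrite comp_lfun1l.
have brX : hopf_map X = \1%VF.
  rewrite /hopf_map !braiding_flip.
  rewrite (tact_Rmat Hsf (concentrated0 kk) (concentrated0 KKX)).
  rewrite (tact_Rmat Hsf (concentrated0 KKX) (concentrated0 kk)).
  rewrite !tact_rho !(actM X (f _ _)) !fX comp_lfun0l.
  have t0r (B : 'End(P)) : tmap B 0 = 0 :> 'End(tens P X).
    by apply: tens_ext => u w; rewrite tmapE !zero_lfunE pure0r.
  have t0l (B : 'End(P)) : tmap 0 B = 0 :> 'End(tens X P).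
    by apply: tens_ext => u w; rewrite tmapE !zero_lfunE pure0l.
  rewrite !t0r !t0l !scaler0 !subr0 !comp_lfun1r !expr0 !expr0z !scale1r.
  (* With K = s on X the Koszul sign acts on P alone: as the identity for s = 1 and as [k] for s =
     -1. The braidings in both directions contribute it, and its square is 1. *)
  pose z v := 2^-1 *: (v + k v + sgn C s *: v - sgn C s *: k v).
  have zz v : z (z v) = v.
    rewrite /z; push_linear; rewrite !kk.
    have [->|->] : sgn C s = 1 \/ sgn C s = -1 by case: (s); [left|right].
      by move: (k v) => u; coordinates; field.
    by move: (k v) => u; coordinates; field.
  have pf1 v w : parity_form k (act X K) (pure v w) = pure (z v) w.
    by rewrite parity_formE KX !lfunOpE /z !pureE.
  have pf2 v w : parity_form (act X K) k (pure w v) = pure w (z v).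
    rewrite parity_formE KX !lfunOpE /z !pureE.
    by tensor_coordinates; ring.
  by apply: tens_ext => v w; rewrite !comp_lfunE pf1 flipE pf2 flipE zz
    id_lfunE.
apply/lfunP => v; rewrite RT_hopf twXb brX scale_lfunE.
under eq_bigr do rewrite id_lfunE.
rewrite slice_tmap; congr (_ *: _).
have -> : (act X (antip H (evel H) * pivot H) \o \1 \o act X (coevel H))%VF =
    sgn C s *: \1%VF.
  apply/lfunP => w; rewrite !comp_lfunE id_lfunE (sf_coevelE Hsf) /bbeta actDv
    Xe0.
  rewrite (actZv (beta ^+ 2)) (actMv _ (e1 K)) Xe1 lf0 scaler0 addr0.
  rewrite (sf_evelE Hsf) antip1 mul1r (sf_pivotE Hsf) /sf_pivot actMv actDv Xe0.
  by rewrite (actZv ((- 'i) ^+ 3)) actMv Xe1 scaler0 addr0 KX.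
rewrite trcZ /trc; under eq_bigr do rewrite id_lfunE bcovec_bvec eqxx.
by rewrite sumr_const card_ord dimX mulr1.
Qed.

(** * The Hopf link with X_1 *)

Section HopfX1.
Variables (s : bool) (X : amod H).
Hypothesis HX : is_X1 K f s X.
Local Notation J := ('i *: act X K).

Let XKK v : act X K (act X K v) = - v.
Proof.
(* K^2 is central and multiplies [e1pm] by -1, so [X1_central] transports this scalar to X. *)
have zC : forall a, K ^+ 2 * a = a * K ^+ 2.
  have U2 : K ^+ 2 \is a GRing.unit.
    by apply/unitrP; exists (K ^+ 2); rewrite -exprD (rel_K4 rel).
  apply: (presented_central (sf_pres Hsf) U2); first by rewrite -exprS -exprSr.
  by move=> i t; rewrite (KK_f rel).
rewrite -actMv -expr2 (X1_central v HX zC (c := -1)) ?scaleN1r //.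
by rewrite /e1pm -scalerAr mulrA (KK_e1 rel) mulNr scalerN.
Qed.

Let Xe1 v : act X (e1 K) v = v.
Proof.
rewrite act_e1 XKK opprK -mulr2n -scaler_nat scalerA mulVf ?scale1r //.
exact: two_neq0.
Qed.

Let Xe0 v : act X (e0 K) v = 0.
Proof. by rewrite act_e0 XKK subrr scaler0. Qed.

Lemma X1_ribbon v : act X (ribbon H) v = (beta * sgn C s) *: v.
Proof.
apply: (X1_central v HX); rewrite (sf_ribbonE Hsf); last exact: ribbon_e1pm.
apply: (presented_central (sf_pres Hsf)).
- exact: (ribbon_unit rel beta_neq0).
- exact: ribbon_K.
- exact: ribbon_f.
Qed.

Lemma X1_twist_scalar b : exists c,
  RT (gpow (gtwist (wpt X)) (gtwist_inv (wpt X)) b) = c *: \1%VF.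
Proof.
pose c := (beta * sgn C s)^-1.
have c0 : c != 0.
  rewrite invr_eq0 mulf_neq0 ?beta_neq0 //; case: (s) => /=.
    exact: oner_neq0.
  by rewrite oppr_eq0 oner_neq0.
exists (c ^ b); apply: (@RT_gpow _ H (wpt X) _ _ (fun n => c ^ n *: \1%VF)) =>
  //=.
- by rewrite expr0z scale1r.
- move=> m n; rewrite -comp_lfunZl -comp_lfunZr comp_lfun1l scalerA.
  by rewrite expfzDr.
rewrite expr1z; apply/lfunP => v; rewrite /twist !lfunOpE.
have bs0 : beta * sgn C s != 0 by rewrite -invr_eq0.
by rewrite -[in RHS](ribbonV v) X1_ribbon lfZ scalerA mulVf ?scale1r.
Qed.

Lemma one_sub2E (V : vectType C) (T : 'End(V)) t :
  (\1 - 2 *: T)%VF t = t - 2 *: T t.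
Proof. by rewrite !lfunOpE. Qed.

Lemma parity_form_odd (A : 'End(P)) (B : 'End(X)) :
  (forall v, A (k v) = - k (A v)) ->
  (forall v, B (act X K v) = - act X K (B v)) ->
  (tmap A (B \o J) \o parity_form k J)%VF =
  (parity_form k J \o - tmap (A \o k) B)%VF.
Proof.
move=> Ak BJ; apply: tens_ext => v w.
have JJ u : J (J u) = u.
  by rewrite !scale_lfunE lfZ XKK !scalerN scalerA -expr2 sqrCi scaleN1r opprK.
have {}BJ u : B (J u) = - J (B u) by rewrite !scale_lfunE lfZ BJ scalerN.
move: (J) JJ BJ => j JJ BJ.
rewrite !comp_lfunE opp_lfunE tmapE parity_formE lfN parity_formE.
push_linear; rewrite !tmapE !comp_lfunE.
repeat (progress rewrite ?Ak ?BJ ?JJ ?kk ?lfN).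
by tensor_coordinates; field.
Qed.

(** Replacing J by -J swaps its eigenspaces, so the two signs cancel except for the parity of the P
    slot. *)
Lemma parity_formM :
  (parity_form k (- J) \o parity_form k J)%VF = tmap k \1 :> 'End(tens P X).
Proof.
apply: tens_ext => v w.
have JJ u : J (J u) = u.
  by rewrite !scale_lfunE lfZ XKK !scalerN scalerA -expr2 sqrCi scaleN1r opprK.
move: (J) JJ => j JJ.
rewrite !comp_lfunE tmapE id_lfunE parity_formE; push_linear.
rewrite !parity_formE !opp_lfunE !JJ !kk.
by tensor_coordinates; field.
Qed.

Local Notation factor i t := (\1 - 2 *: tmap (act P (f i t) \o k) (act X (f i
  (~~ t))))%VF.

(** The factors with f^- on P come from the braiding of P past X. Those with f^+ come from the
    return braiding, after passing the flip and the first Koszul sign. The trailing identity gives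
    every tail the form expected by [null_step]. *)
Lemma hopf_map_X1 : hopf_map X = (tmap k \1 \o (factor ord0 true \o
  (factor ord_max true \o (factor ord0 false \o (factor ord_max false \o
    \1)))))%VF.
Proof.
have omegaX : act X (omega K false) = - J.
  apply/lfunP => v; rewrite /omega actMv actDv Xe0 add0r (actZv (_ * _)) Xe1.
  by rewrite opp_lfunE scale_lfunE mulN1r scaleNr.
have pf_flip A t : parity_form A k (flip P X t) = flip P X (parity_form k A t).
  rewrite -!comp_lfunE; congr fun_of_lfun; apply: tens_ext => u w.
  rewrite !comp_lfunE flipE !parity_formE; push_linear; rewrite !flipE.
  by tensor_coordinates; ring.
have q_flip (A : 'End(P)) (B : 'End(X)) t :
    (\1 - 2 *: tmap B A)%VF (flip P X t) = flip P X ((\1 - 2 *: tmap A B)%VF t).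
  rewrite -!comp_lfunE; congr fun_of_lfun; apply: tens_ext => u w.
  by rewrite !comp_lfunE flipE !one_sub2E !tmapE lfD lfN lfZ !flipE.
have q_parity i s' t :
    (\1 - 2 *: tmap (act P (f i s')) (act X (f i (~~ s')) \o - J))%VF
      (parity_form k J t) = parity_form k J (factor i s' t).
  rewrite !one_sub2E (lfD (parity_form k J)) (lfN (parity_form k J)).
  rewrite (lfZ (parity_form k J)); congr (_ - _ *: _).
  have E : (tmap (act P (f i s')) (act X (f i (~~ s')) \o - J) =
      - tmap (act P (f i s')) (act X (f i (~~ s')) \o J))%VF.
    by apply: tens_ext => u w; rewrite opp_lfunE !tmapE !comp_lfunE opp_lfunE
      lfN pureNr.
  rewrite E opp_lfunE -comp_lfunE parity_form_odd.
  - by rewrite comp_lfunE opp_lfunE lfN opprK.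
  - by move=> u; rewrite (act_fK rel).
  by move=> u; rewrite (act_fK rel).
apply/lfunP => t; rewrite /hopf_map !braiding_flip.
rewrite (tact_Rmat Hsf (concentrated0 kk) (concentrated1 XKK)).
rewrite (tact_Rmat Hsf (concentrated1 XKK) (concentrated0 kk)).
rewrite !tact_rho /= !muln0 !mul0n !expr0 !expr0z !scale1r expr1z.
have -> : 'i ^ (- 1%N%:Z) *: act X K = - J.
  by rewrite exprN1 invCi scaleNr.
rewrite !(actM _ (f _ _)) P_omega omegaX comp_lfun1r.
move: (parity_formM) => pfM.
rewrite [LHS]comp_lfunE ![in LHS](comp_lfunE (flip _ _)) ![(_ \o _)%VF
  _]comp_lfunE.
have flipK' u : flip X P (flip P X u) = u by rewrite -comp_lfunE flipK id_lfunE.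
rewrite !q_flip pf_flip flipK' (q_parity ord_max true) (q_parity ord0 true).
by rewrite -[LHS]comp_lfunE pfM.
Qed.

Definition null (G : 'End(tens P X)) :=
  forall v, \sum_i slice P (bcovec i \o act X K)%VF (G (pure v (bvec i))) = 0.

Lemma null_step (A A' : 'End(P)) b b' R :
  null (tmap A (act X b) \o R)%VF ->
  null (tmap (A \o A') (act X (b * b')) \o R)%VF ->
  null (tmap A (act X b) \o ((\1 - 2 *: tmap A' (act X b')) \o R))%VF.
Proof.
move=> N1 N2 v.
have E : (tmap A (act X b) \o ((\1 - 2 *: tmap A' (act X b')) \o R))%VF =
   (tmap A (act X b) \o R - 2 *: (tmap (A \o A') (act X (b * b')) \o R))%VF.
  apply/lfunP => t; rewrite !lfunOpE lfD lfN lfZ; congr (_ - _ *: _).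
  move: (R t) => {}t; rewrite -comp_lfunE; congr fun_of_lfun.
  by apply: tens_ext => u w; rewrite comp_lfunE !tmapE comp_lfunE actMv.
transitivity (\sum_i slice P (bcovec i \o act X K)%VF ((tmap A (act X b) \o
  R)%VF (pure v (bvec i)))
   - 2 *: \sum_i slice P (bcovec i \o act X K)%VF ((tmap (A \o A') (act X (b *
     b')) \o R)%VF (pure v (bvec i)))).
  rewrite E scaler_sumr -sumrB; apply: eq_bigr => i _.
  by rewrite add_lfunE opp_lfunE scale_lfunE lfD lfN lfZ.
by rewrite N1 N2 scaler0 subr0.
Qed.

Lemma null_trace (A : 'End(P)) b :
  trc (act X (K * b)) = 0 -> null (tmap A (act X b) \o \1)%VF.
Proof.
move=> t0 v; rewrite comp_lfun1r.
have := slice_tmap A (act X b) (act X K) \1%VF v.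
under eq_bigr do rewrite id_lfunE.
by move=> ->; rewrite comp_lfun1r -actM t0 scale0r.
Qed.

Lemma null_vanish (A : 'End(P)) b :
  (forall v, A v = 0) -> null (tmap A (act X b) \o \1)%VF.
Proof.
move=> A0 v; rewrite comp_lfun1r big1 // => i _.
by rewrite tmapE A0 pure0l lf0.
Qed.

Lemma hopf_map_X1_null : null (hopf_map X).
Proof.
have tKff i j t u : trc (act X (K * (1 * f i t * f j u))) = 0.
  by rewrite mul1r mulrA (tau_Kff rel Xe1).
have tKf i t : trc (act X (K * (1 * f i t))) = 0.
  by rewrite mul1r (tau_Kf rel).
have z3 i j l t u w v : (((k \o (act P (f i t) \o k)) \o (act P (f j u) \o k))
    \o (act P (f l w) \o k))%VF v = 0.
  rewrite !comp_lfunE; repeat (progress rewrite ?(act_fK rel) ?lfN).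
  by rewrite (P_f3 rel basisP kv0 f2E) !lf0 ?oppr0.
have v3 i j l t u w (b : H) : null (tmap (((k \o (act P (f i t) \o k))
    \o (act P (f j u) \o k)) \o (act P (f l w) \o k)) (act X b) \o \1)%VF.
  by apply: null_vanish => v; apply: z3.
have v4 i j l m t u w z (b : H) : null (tmap ((((k \o (act P (f i t) \o k))
    \o (act P (f j u) \o k)) \o (act P (f l w) \o k))
    \o (act P (f m z) \o k)) (act X b) \o \1)%VF.
  by apply: null_vanish => v; rewrite comp_lfunE; apply: z3.
rewrite hopf_map_X1 -(act1 X).
(* Each factor splits a term in two, according to whether its bilinear is chosen; the sixteen
   resulting goals are sorted by the number of fermions. *)
apply: null_step; apply: null_step; apply: null_step; apply: null_step.
- by apply: null_trace; rewrite mulr1 (tau_K rel).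
- exact: null_trace.
- exact: null_trace.
- exact: null_trace.
- exact: null_trace.
- exact: null_trace.
- exact: null_trace.
- exact: v3.
- exact: null_trace.
- exact: null_trace.
- exact: null_trace.
- exact: v3.
- exact: null_trace.
- exact: v3.
- exact: v3.
- exact: v4.
Qed.

Lemma RT_hopf_X1 a b : RT (cut (hopf_link P a X b)) = 0.
Proof.
have [c tw] := X1_twist_scalar b.
apply/lfunP => v; rewrite RT_hopf tw zero_lfunE.
have Xcoev w : act X (coevel H) w = beta ^+ 2 *: w.
  rewrite (sf_coevelE Hsf) /bbeta actDv Xe0 (actZv (beta ^+ 2)) (actMv _ (e1
    K)) Xe1 add0r.
  rewrite /sgn mul1r exprZn actZv sqrCi scaleN1r.
  by rewrite expr2 actMv XKK opprK.
have Xpiv w : act X (antip H (evel H) * pivot H) w = - (- 'i) ^+ 3 *: act X K w.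
  rewrite (sf_evelE Hsf) antip1 mul1r (sf_pivotE Hsf) /sf_pivot actMv actDv Xe0
    add0r.
  rewrite (actZv ((- 'i) ^+ 3)) (actMv (e1 K)) Xe1 expr2 actMv XKK.
  by rewrite scalerN scaleNr.
(* The twist, the coevaluation element and the pivot act on X as scalars times 1, 1 and K, so they
   factor out of the partial trace with K. *)
transitivity ((c * beta ^+ 2 * - (- 'i) ^+ 3) *: unipotent (2 * a%:~R * D)
   (\sum_i slice P (bcovec i \o act X K)%VF (hopf_map X (pure v (bvec i))))).
  rewrite lf_sum scaler_sumr; apply: eq_bigr => i _.
  rewrite Xcoev pureZr !lfZ; move: (hopf_map X _) => t.
  set U := unipotent _; set g := (bcovec i \o act X (_ * _))%VF.
  have E : (beta ^+ 2 *: (slice P g \o tmap U (c *: \1)) =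
     (c * beta ^+ 2 * - (- 'i) ^+ 3) *: (U \o slice P (bcovec i \o act X
       K)))%VF.
    apply: tens_ext => u w; rewrite !scale_lfunE !comp_lfunE tmapE !sliceE lfZ.
    rewrite !scalerA /g !comp_lfunE scale_lfunE id_lfunE Xpiv !lfZ.
    by congr (_ *: _); rewrite /GRing.scale /=; ring.
  by move/lfunP/(_ t): E; rewrite !scale_lfunE !comp_lfunE.
by rewrite hopf_map_X1_null lf0 scaler0.
Qed.

End HopfX1.

End Invariants.

Lemma amorph_comp (F : fieldType) (B : falgType F) (L M N : amod B)
    (g : 'Hom(M, N)) (h : 'Hom(L, M)) :
  amorph g -> amorph h -> amorph (g \o h)%VF.
Proof.
move=> /amorphE mg /amorphE mh; apply/amorphE => a v.
by rewrite !comp_lfunE mh mg.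
Qed.

(** * The subalgebra A and the restriction of P_mu to it *)

Section FirstFermion.
Variables (C : numClosedFieldType) (H : rqHopf C) (K : H).
Variables (f : 'I_2 -> bool -> H).
Hypothesis rel : sf_relations K f.
Variables (A : qHopf C) (inc : subqHopf A H).
Variables (kA xA yA : A).
Hypotheses (inck : inc kA = K) (incx : inc xA = f ord0 true)
  (incy : inc yA = f ord0 false).
Hypothesis genA : first_fermion K f inc.

Lemma amorph_gen (M N : amod A) (g : 'Hom(M, N)) :
  (forall v, g (act M kA v) = act N kA (g v)) ->
  (forall v, g (act M xA v) = act N xA (g v)) ->
  (forall v, g (act M yA v) = act N yA (g v)) -> amorph g.
Proof.
move=> gk gx gy.
pose G (a : A) : 'Hom(M, N) := ((g \o act M a) - (act N a \o g))%VF.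
have Glin : linear G.
  move=> c a b; apply/lfunP => v; rewrite /G !lfunOpE !actDv !actZv lfD lfZ.
  move: (g (act M a v)) (g _) (act N a _) (act N b _) => u u' w w'.
  by coordinates; ring.
pose V := lker (linfun G).
have VP a : a \in V -> forall v, g (act M a v) = act N a (g v).
  rewrite memv_ker (lfun_linE Glin) subr_eq0 => /eqP E v.
  by rewrite -!comp_lfunE E.
have PV a : (forall v, g (act M a v) = act N a (g v)) -> a \in V.
  move=> E; rewrite memv_ker (lfun_linE Glin) subr_eq0; apply/eqP/lfunP => v.
  by rewrite !comp_lfunE.
suff VA a : a \in V.
  by apply/amorphE => a v; apply: VP.
(* The elements of A intertwined by [g] contain 1 and are closed under products, so their image
   contains the algebra generated by K, f_1^+ and f_1^-. *)
have sub : (agenv <<[:: K; f ord0 true; f ord0 false]>> <= inc @: V)%VS.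
  apply: agenv_sub_modl.
    rewrite -memvE -(incl1 inc) memv_img //; apply: PV => v.
    by rewrite !act1v.
  apply/prodvP => u w Uu /memv_imgP[b Vb ->].
  have : u \in (inc @: V)%VS.
    move: u Uu; apply/subvP/span_subvP => u; rewrite !inE.
    by case/or3P => /eqP ->; rewrite -?inck -?incx -?incy memv_img ?PV.
  case/memv_imgP => a' Va' ->; rewrite -inclM memv_img //.
  by apply: PV => v; rewrite !actMv !VP.
have : inc a \in limg inc by rewrite memv_img ?memvf.
rewrite genA => /(subvP sub) /memv_imgP[b Vb /(@incl_inj _ _ _ inc) ->].
exact: Vb.
Qed.

Lemma A_xk : xA * kA = - (kA * xA).
Proof. by apply: (@incl_inj _ _ _ inc); rewrite lfN !inclM inck incx (rel_fKN
  rel). Qed.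

Lemma A_yk : yA * kA = - (kA * yA).
Proof. by apply: (@incl_inj _ _ _ inc); rewrite lfN !inclM inck incy (rel_fKN
  rel). Qed.

Lemma A_xx : xA * xA = 0.
Proof. by apply: (@incl_inj _ _ _ inc); rewrite lf0 inclM incx (rel_ff0 rel).
  Qed.

Lemma A_yy : yA * yA = 0.
Proof. by apply: (@incl_inj _ _ _ inc); rewrite lf0 inclM incy (rel_ff0 rel).
  Qed.

Lemma A_yx : yA * xA = 2^-1 *: (1 - kA * kA) - xA * yA.
Proof.
apply: (@incl_inj _ _ _ inc); rewrite lfD lfN lfZ lfD lfN !inclM incl1 incx
  incy inck.
by rewrite (rel_mp rel) eqxx scale1r /e1 expr2.
Qed.

Lemma A_k4 : kA ^+ 4 = 1.
Proof.
apply: (@incl_inj _ _ _ inc); rewrite incl1 -(rel_K4 rel) -inck.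
by rewrite !exprS !expr0 !mulr1 !inclM.
Qed.

(** The averaging projector onto vectors fixed by K. *)
Definition vacuum : A := 4^-1 *: (1 + kA + kA ^+ 2 + kA ^+ 3).

Lemma k_vacuum : kA * vacuum = vacuum.
Proof.
rewrite /vacuum -scalerAr !mulrDr mulr1 -expr2 -!exprS A_k4.
by rewrite addrC !addrA.
Qed.

Lemma vacuumM (a : A) : kA * a = a -> vacuum * a = a.
Proof.
move=> ka; have kn n : kA ^+ n * a = a.
  by elim: n => [|n IH]; rewrite ?expr0 ?mul1r // exprS -mulrA IH.
rewrite /vacuum -scalerAl !mulrDl !kn ka mul1r.
by coordinates; field.
Qed.

Lemma act_vacuum (M : amod A) m : act M kA m = m -> act M vacuum m = m.
Proof.
move=> km; have kn n : act M (kA ^+ n) m = m.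
  by elim: n => [|n IH]; rewrite ?expr0 ?act1v // exprS actMv IH.
rewrite /vacuum actZv !actDv !kn km act1v.
by coordinates; field.
Qed.

Section Universal.
Variables (P : amod H) (v0 : P).
Local Notation k := (act P K).
Local Notation x := (act P (f ord0 true)).
Local Notation y := (act P (f ord0 false)).
Local Notation rP := (res_mod inc P).
Hypothesis basisP : basis_of {:P} [:: v0; x v0; y v0; x (y v0)].
Hypothesis kv0 : k v0 = v0.

Lemma act_res a v : act rP a v = act P (inc a) v.
Proof. by rewrite /= comp_lfunE. Qed.

(** The basis of P forces the images m, x m, y m, x y m. The relations of P hold for them because
    K^2 fixes m and y m, so x and y anticommute there as they do on P. *)
Lemma P_universal (M : amod A) m : act M kA m = m ->
  exists2 h : 'Hom(P, M), @amorph _ _ rP M h & h v0 = m.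
Proof.
move=> km.
pose b := [tuple v0; x v0; y v0; x (y v0)].
have fb : free b by apply: basis_free basisP.
pose hf (v : P) : M := coord b (inord 0) v *: m + coord b (inord 1) v *: act M
  xA m
  + coord b (inord 2) v *: act M yA m + coord b (inord 3) v *: act M xA (act M
    yA m).
have hlin : linear hf.
  by move=> c u v; rewrite /hf !linearP /=; coordinates; ring.
have cb (i j : nat) : (i < 4)%N -> (j < 4)%N -> coord b (inord i) b`_j = (i ==
  j)%:R.
  move=> i4 j4; rewrite -{1}(inordK j4) coord_free // -val_eqE /= !inordK //.
  by rewrite eq_sym.
have h0 : linfun hf v0 = m.
  rewrite (lfun_linE hlin) /hf -[v0]/(b`_0) !cb //= !scale0r scale1r.
  by rewrite !addr0.
have h1 : linfun hf (x v0) = act M xA m.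
  rewrite (lfun_linE hlin) /hf -[x v0]/(b`_1) !cb //= !scale0r scale1r.
  by rewrite !addr0 add0r.
have h2 : linfun hf (y v0) = act M yA m.
  rewrite (lfun_linE hlin) /hf -[y v0]/(b`_2) !cb //= !scale0r scale1r.
  by rewrite !addr0 !add0r.
have h3 : linfun hf (x (y v0)) = act M xA (act M yA m).
  rewrite (lfun_linE hlin) /hf -[x (y v0)]/(b`_3) !cb //= !scale0r scale1r.
  by rewrite !add0r.
exists (linfun hf) => //; move: (linfun hf) h0 h1 h2 h3 => h h0 h1 h2 h3.
have Mxk u : act M xA (act M kA u) = - act M kA (act M xA u).
  by rewrite -!actMv A_xk actNv.
have Myk u : act M yA (act M kA u) = - act M kA (act M yA u).
  by rewrite -!actMv A_yk actNv.
have Mxx u : act M xA (act M xA u) = 0 by rewrite -actMv A_xx act0v.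
have Myy u : act M yA (act M yA u) = 0 by rewrite -actMv A_yy act0v.
have Mkx u : act M kA (act M xA u) = - act M xA (act M kA u) by rewrite Mxk
  opprK.
have Mky u : act M kA (act M yA u) = - act M yA (act M kA u) by rewrite Myk
  opprK.
have Myx u : act M kA (act M kA u) = u ->
    act M yA (act M xA u) = - act M xA (act M yA u).
  move=> kku; rewrite -actMv A_yx actDv actNv actZv actDv actNv act1v !actMv
    kku.
  by rewrite subrr scaler0 add0r.
have ext (g g' : 'Hom(P, M)) := P_ext basisP (g := g) (h := g').
have pkf i s u : k (act P (f i s) u) = - act P (f i s) (k u).
  by rewrite (act_fK rel) opprK.
have Pyx := P_yx rel basisP kv0.
apply: (@amorph_gen rP M h) => v; rewrite act_res ?inck ?incx ?incy.
- rewrite -[LHS]comp_lfunE -[RHS]comp_lfunE; congr fun_of_lfun.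
  apply: ext; rewrite !comp_lfunE ?pkf !kv0 ?lfN ?pkf ?kv0 ?lfN ?opprK.
  - by rewrite h0 km.
  - by rewrite h1 Mkx km.
  - by rewrite h2 Mky km.
  by rewrite h3 Mkx Mky km lfN opprK.
- rewrite -[LHS]comp_lfunE -[RHS]comp_lfunE; congr fun_of_lfun.
  apply: ext; rewrite !comp_lfunE ?(act_ff0 rel) ?lf0.
  - by rewrite h0 h1.
  - by rewrite h1 Mxx.
  - by rewrite h2 h3.
  by rewrite h3 Mxx.
rewrite -[LHS]comp_lfunE -[RHS]comp_lfunE; congr fun_of_lfun.
apply: ext; rewrite !comp_lfunE ?Pyx ?(act_ff0 rel) ?lfN ?lf0.
- by rewrite h0 h2.
- by rewrite h1 h3 Myx // !km.
- by rewrite h2 Myy.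
rewrite oppr0 h3 Myx; first by rewrite Myy lf0 oppr0.
by rewrite Mky km lfN Mky km opprK.
Qed.

Lemma P_generated (M : amod A) (g h : 'Hom(P, M)) :
  @amorph _ _ rP M g -> @amorph _ _ rP M h -> g v0 = h v0 -> g = h.
Proof.
move=> /amorphE mg /amorphE mh gh.
have gx u : g (x u) = act M xA (g u) by rewrite -incx -act_res mg.
have gy u : g (y u) = act M yA (g u) by rewrite -incy -act_res mg.
have hx u : h (x u) = act M xA (h u) by rewrite -incx -act_res mh.
have hy u : h (y u) = act M yA (h u) by rewrite -incy -act_res mh.
by apply: (P_ext basisP); rewrite ?gx ?hx ?gy ?hy gh.
Qed.

(** Any lift of the image of v0, projected by [vacuum], is fixed by K and still a lift; universality
    extends it to a map. *)
Lemma P_projective : in_ideal inc P.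
Proof.
move=> M N g h mg gM mh.
have /memv_imgP[m1 _ m1E] : h v0 \in limg g by rewrite gM memvf.
have kv0' : act rP kA v0 = v0 by rewrite act_res inck.
have km : act M kA (act M vacuum m1) = act M vacuum m1.
  by rewrite -actMv k_vacuum.
have [q mq q0] := P_universal km.
exists q => //; apply: P_generated => //.
  exact: amorph_comp.
rewrite comp_lfunE q0; move/amorphE: mg => ->; rewrite -m1E.
by move/amorphE: mh => <-; rewrite act_vacuum.
Qed.

Local Notation Ae := (left_ideal_mod vacuum).
Local Notation gen := (left_ideal_gen vacuum).

Lemma vacuum_idem : vacuum * vacuum = vacuum.
Proof. exact/vacuumM/k_vacuum. Qed.

Lemma act_Ae (a : A) (u : Ae) : vsval (act Ae a u) = a * vsval u.
Proof.
by rewrite /= (lfun_linE (@left_ideal_act_linear _ _ _)) left_ideal_actE.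
Qed.

Lemma val_gen : vsval gen = vacuum.
Proof. by rewrite vsprojK // mem_left_ideal. Qed.

Lemma Ae_gen (u : Ae) : act Ae (vsval u) gen = u.
Proof.
apply: subvs_inj; rewrite act_Ae val_gen.
have /memv_imgP[b _ ->] := subvsP u.
by rewrite !lfunE /= -mulrA vacuum_idem.
Qed.

Definition orbit_map (M : amod A) (m : M) : 'Hom(Ae, M) :=
  linfun (fun u : Ae => act M (vsval u) m).

Lemma orbit_mapE (M : amod A) (m : M) u : orbit_map m u = act M (vsval u) m.
Proof.
rewrite /orbit_map lfun_linE // => c v w.
by rewrite -actZv -actDv; congr (act M _ m).
Qed.

Lemma orbit_map_morph (M : amod A) (m : M) : amorph (orbit_map m).
Proof. by apply/amorphE => a u; rewrite !orbit_mapE act_Ae actMv. Qed.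

Lemma Ae_projective : aprojective Ae.
Proof.
move=> M N g h /amorphE mg gM /amorphE mh.
have /memv_imgP[m _ mE] : h gen \in limg g by rewrite gM memvf.
exists (orbit_map m); first exact: orbit_map_morph.
apply/lfunP => u; rewrite comp_lfunE orbit_mapE mg -mE -mh.
by rewrite Ae_gen.
Qed.

(** * The modified trace on P_mu *)

Section Trace.
Variables (beta : C) (lam : 'Hom(A, C^o)).
Variable tA : forall X : amod A, 'End(X) -> C.
Hypotheses (Hlam : sf_lambda K f beta inc lam) (HtA : right_modified_trace tA)
  (HtAlam : trace_from_form lam tA).

Lemma lam_monomial (s t : 'I_2) (m : 'I_4) :
  lam (xA ^+ s * yA ^+ t * kA ^+ m) = if (s == 1%N :> nat) && (t == 1%N :> nat)
            then (m == 1%N :> nat)%:R - 'i * beta ^+ 2 * (m == 3%N :> nat)%:R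
            else 0.
Proof.
have incX (a : A) n : inc (a ^+ n) = inc a ^+ n.
  by elim: n => [|n IH]; rewrite ?expr0 ?incl1 // !exprS inclM IH.
by apply: Hlam; rewrite !inclM !incX incx incy inck.
Qed.

Lemma lam_vacuum : lam vacuum = 0.
Proof.
rewrite /vacuum lfZ !lfD.
have E (m : nat) : (m < 4)%N -> lam (kA ^+ m) = 0.
  by move=> m4; have := lam_monomial ord0 ord0 (Ordinal m4); rewrite !expr0
    !mul1r.
have := (E 0%N isT, E 1%N isT); rewrite expr0 expr1 => -[-> ->].
by rewrite !E // !addr0 scaler0.
Qed.

Lemma lam_top : lam (xA * yA * vacuum) = 4^-1 * (1 - 'i * beta ^+ 2).
Proof.
rewrite /vacuum -scalerAr lfZ !mulrDr !lfD.
have E (m : nat) : (m < 4)%N -> lam (xA * yA * kA ^+ m) =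
    (m == 1%N)%:R - 'i * beta ^+ 2 * (m == 3%N)%:R.
  move=> m4; have := lam_monomial ord_max ord_max (Ordinal m4).
  by rewrite !expr1.
have := (E 0%N isT, E 1%N isT); rewrite expr0 expr1 => -[-> ->].
by rewrite !E // /GRing.scale /=; ring.
Qed.

Lemma tA_P (G : 'End(P)) c d : @amorph _ _ rP rP G ->
  G v0 = c *: v0 + d *: x (y v0) ->
  @tA rP G = d * (4^-1 * (1 - 'i * beta ^+ 2)).
Proof.
move=> mG G0.
have kgen : act Ae kA gen = gen by apply: subvs_inj; rewrite act_Ae val_gen
  k_vacuum.
have [h mh h0] := P_universal kgen.
pose psi := @orbit_map rP v0.
have mpsi : amorph psi by apply: orbit_map_morph.
have psih : (psi \o h)%VF = \1%VF.
  apply: (@P_generated rP); first exact: amorph_comp.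
    by apply/amorphE => a v; rewrite !id_lfunE.
  rewrite comp_lfunE h0 id_lfunE orbit_mapE val_gen act_vacuum //.
  by rewrite act_res inck.
have mhG : @amorph _ _ rP Ae (h \o G)%VF by apply: (@amorph_comp _ _ rP rP Ae).
have := mtr_cyclic HtA P_projective Ae_projective mhG mpsi.
rewrite comp_lfunA psih comp_lfun1l => ->.
rewrite (HtAlam vacuum_idem); last exact: amorph_comp.
rewrite !comp_lfunE orbit_mapE val_gen act_vacuum; last by rewrite act_res inck.
rewrite G0 lfD !lfZ h0.
have -> : h (x (y v0)) = act Ae (xA * yA) gen.
  move/amorphE: mh => mh.
  by rewrite actMv -h0 -!mh !act_res incx incy.
have -> : vsval (c *: gen + d *: act Ae (xA * yA) gen) =
    c *: vacuum + d *: (xA * yA * vacuum).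
  by rewrite -[vacuum in RHS]val_gen -[xA * yA * _]act_Ae.
by rewrite lfD (lfZ lam c) (lfZ lam d) lam_vacuum lam_top scaler0 add0r.
Qed.

End Trace.

End Universal.
End FirstFermion.

(** * Normalisation of the trace and conclusion *)

Lemma det_mx2 (R : comNzRingType) (M : 'M[R]_2) :
  \det M = M ord0 ord0 * M ord_max ord_max - M ord0 ord_max * M ord_max ord0.
Proof.
have l01 : lift (ord0 : 'I_2) ord0 = ord_max by apply: val_inj.
have l10 : lift (ord_max : 'I_2) ord0 = ord0 by apply: val_inj.
rewrite (expand_det_row _ ord0) big_ord_recl big_ord1 l01 /cofactor !det_mx11
  !mxE.
by rewrite l01 l10 expr0 expr1 mul1r mulN1r mulrN.
Qed.

Lemma ideal_trace_unipotent (C : numClosedFieldType) (beta : C)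
    (H : rqHopf C) (K : H) (f : 'I_2 -> bool -> H) (A : qHopf C)
    (inc : subqHopf A H) (lam : 'Hom(A, C^o))
    (tA : forall X : amod A, 'End(X) -> C) (P : amod H) (v0 : P) (c t : C) :
  beta ^+ 4 = 1 -> sf_relations K f -> first_fermion K f inc ->
  sf_lambda K f beta inc lam -> right_modified_trace tA ->
  trace_from_form lam tA ->
  basis_of {:P} [:: v0; act P (f ord0 true) v0; act P (f ord0 false) v0;
    act P (f ord0 true) (act P (f ord0 false) v0)] ->
  act P K v0 = v0 ->
  in_ideal inc P /\ ideal_trace beta inc tA (c *: unipotent f P t) = c * t.
Proof.
move=> beta4 rel genA Hlam HtA HtAlam basisP kv0.
have inA u : u \in [:: K; f ord0 true; f ord0 false] -> exists a, inc a = u.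
  move=> su; have : u \in limg inc by rewrite genA; apply/(subvP (sub_agenv
    _))/memv_span.
  by case/memv_imgP => a _ ->; exists a.
have [kA inck] := inA K (mem_head _ _).
have [xA incx] : exists a, inc a = f ord0 true by apply: inA; rewrite !inE eqxx
  orbT.
have [yA incy] : exists a, inc a = f ord0 false by apply: inA; rewrite !inE
  eqxx !orbT.
split; first exact: (P_projective rel inck incx incy genA basisP kv0).
set G := c *: unipotent f P t.
have GE v : G v = c *: v + (c * t) *: act P (f ord0 true) (act P (f ord0 false)
  v).
  by rewrite scale_lfunE unipotentE scalerDr scalerA.
have kk := P_KK rel basisP kv0.
have yx := P_yx rel basisP kv0.
have mG : @amorph _ _ (res_mod inc P) (res_mod inc P) G.
  apply: (amorph_gen inck incx incy genA) => v; rewrite !act_res ?inck ?incx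
    ?incy.
  - by rewrite !GE lfD !lfZ !(act_fK rel) lfN (act_fK rel) opprK.
  - by rewrite !GE lfD !lfZ yx lfN !(act_ff0 rel) oppr0.
  by rewrite !GE lfD !lfZ yx !(act_ff0 rel) lf0 oppr0.
rewrite /ideal_trace (tA_P rel inck incx incy genA basisP kv0 Hlam HtA HtAlam
  mG (GE v0)).
(* If i beta^2 were 1, squaring and beta^4 = 1 would give -1 = 1. *)
have ib0 : 1 - 'i * beta ^+ 2 != 0.
  apply/eqP => /eqP; rewrite subr_eq0 => /eqP E.
  have : (1 : C) = -1.
    by have := congr1 (fun z => z ^+ 2) E; rewrite expr1n exprMn sqrCi -exprM
      beta4 mulr1.
  by apply/eqP; rewrite -addr_eq0 -mulr2n pnatr_eq0.
by field.
Qed.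

Theorem mainTheorem11 (R : realType) (beta : R[i])
    (H : rqHopf R[i]) (K : H) (f : 'I_2 -> bool -> H)
    (A : qHopf R[i]) (inc : subqHopf A H)
    (lam : 'Hom(A, R[i]^o)) (tA : forall X : amod A, 'End(X) -> R[i])
    (mu : 'M[R[i]]_2) (P : amod H) :
  beta ^+ 4 = 1 ->
  symplectic_fermions K f beta ->
  first_fermion K f inc ->
  sf_lambda K f beta inc lam ->
  right_modified_trace tA ->
  trace_from_form lam tA ->
  is_P K f mu P ->
  let F' := renormalised (ideal_trace beta inc tA) in
  in_ideal inc P /\
  [/\ forall n : int, F' (unknot n P) = 2 * n%:~R * (1 + \det mu),
      forall m : int, odd `|m|%N ->
        F' (torus m P) = 2 * m%:~R * (1 + \det mu),
      forall (a b : int) (s : bool) (X : amod H), is_X0 K f s X ->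
        F' (hopf_link P a X b) = sgn R[i] s * (2 * a%:~R * (1 + \det mu)) &
      forall (a b : int) (s : bool) (X : amod H), is_X1 K f s X ->
        F' (hopf_link P a X b) = 0].
Proof.
move=> beta4 Hsf genA Hlam HtA HtAlam [v0 [basisP kv0 f2E]] F'.
have rel := (sf_pres Hsf).1.
have tr c t := ideal_trace_unipotent c t beta4 rel genA Hlam HtA HtAlam basisP
  kv0.
have detE : 1 + (mu ord0 ord0 * mu ord_max ord_max
    - mu ord0 ord_max * mu ord_max ord0) = 1 + \det mu.
  by rewrite det_mx2.
have {}tr c t (G : 'End(P)) : G = c *: unipotent f P t ->
    ideal_trace beta inc tA G = c * t.
  by move=> ->; have [] := tr c t.
split; first by have [] := ideal_trace_unipotent 0 0 beta4 rel genA Hlam HtA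
  HtAlam basisP kv0.
split=> [n|m om|a b s X HX|a b s X HX].
- rewrite -detE -[RHS]mul1r; apply: tr; rewrite scale1r.
  exact: (RT_twist_P beta4 Hsf basisP kv0 f2E n).
- rewrite -detE -[RHS]mul1r; apply: tr; rewrite scale1r.
  exact: (RT_torus Hsf basisP kv0 f2E om).
- rewrite -detE; apply: tr.
  exact: (RT_hopf_X0 beta4 Hsf basisP kv0 f2E a b HX).
(* The zero operator is read as c (1 + t x y) with c = t = 0. *)
rewrite -[RHS](mul0r 0); apply: tr; rewrite scale0r.
exact: (RT_hopf_X1 beta4 Hsf basisP kv0 f2E HX a b).
Qed.
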